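(* Let $r,s\in\mathbb N$, $\boldsymbol m=(m_1,\dots,m_r)\in\mathscr V_r$ and $\boldsymbol n=(n_1,\dots,n_s)\in\mathscr V_s$. Then there is a polynomial $\widetilde\Phi^{(\beta)}_{\boldsymbol m,\boldsymbol n}(y)\in\mathbb Z[\beta,y]$, monic in $y$ of degree $$d=|\boldsymbol m|+|\boldsymbol n|-\binom r2-\binom s2,$$ such that, identically in $\beta$ and $x$, $$\Psi^{(\beta)}_{\boldsymbol m,\boldsymbol n}(x)=\kappa^{(\beta)}_{\boldsymbol m,\boldsymbol n}\,e^{-\frac12(r+s)x^2}\,x^{\frac12(r-s)^2+\beta(r-s)}\,\widetilde\Phi^{(\beta)}_{\boldsymbol m,\boldsymbol n}(x^2).$$ Writing $\widetilde\Phi^{(\beta)}_{\boldsymbol m,\boldsymbol n}(y)=\sum_{k=0}^d\widetilde\phi^{[k]}_{\boldsymbol m,\boldsymbol n}(\beta)\,y^k$, each $\widetilde\phi^{[k]}_{\boldsymbol m,\boldsymbol n}(\beta)\in\mathbb Z[\beta]$ has degree $\le d-k$ in $\beta$. Moreover, as rational functions of $\beta$, $$\widetilde\phi^{[0]}_{\boldsymbol m,\boldsymbol n}(\beta)=(-1)^d\prod_{i=1}^r(\beta+i)_{m_i+1-i}\prod_{j=1}^s(-\beta+j)_{n_j+1-j}\prod_{i=1}^r\prod_{j=1}^s\frac{j-i-\beta}{n_j-m_i-\beta},$$ $\widetilde\phi^{[d]}_{\boldsymbol m,\boldsymbol n}(\beta)=1$, $$\widetilde\phi^{[d-1]}_{\boldsymbol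 m,\boldsymbol n}(\beta)=-\rho_2^++(N-1)\rho_1^+-\binom N3-\beta\bigl(\rho_1^--R+S\bigr),$$ and $$\begin{aligned}\widetilde\phi^{[d-2]}_{\boldsymbol m,\boldsymbol n}(\beta)&=\frac{(\rho_2^+)^2}{2}-\rho_3^+-(N-1)\rho_2^+\rho_1^++\frac{(N-1)(N^2-2N+9)}{6}\rho_2^++\frac{N^2-2N+2}{2}(\rho_1^+)^2\\&\quad-\frac{(N-1)^2(N^2-2N+6)}{6}\rho_1^++\frac{N(N-1)^2(N-2)(N^2-2N+9)}{72}\\&\quad+\beta\Bigl(\rho_2^+\rho_1^--\tfrac32\rho_2^--(N-1)\bigl(\rho_1^+\rho_1^-+\tfrac{r-s}{2}\rho_2^+\bigr)+\tfrac{(N^2-2N+2)(r-s)}{2}\rho_1^+\\&\qquad+\tfrac{(N-1)(N^2-2N+9)}{6}\rho_1^--\tfrac{(N^2-2N+6)(N-1)^2(r-s)}{12}\Bigr)\\&\quad+\beta^2\Bigl(\tfrac{(\rho_1^-)^2}{2}-\tfrac{\rho_1^+}{2}-(R-S)\rho_1^-+\tfrac{R(R+1)+S(S+1)}{2}-RS\Bigr),\end{aligned}$$ where $N=r+s$, $\rho_k^\pm=\sum_{i=1}^rm_i^k\pm\sum_{j=1}^sn_j^k$, $R=\binom r2$, $S=\binom s2$.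
   Context: $\mathbb N=\{0,1,2,\dots\}$; $(z)_m=\prod_{j=0}^{m-1}(z+j)$ is the rising Pochhammer symbol. For $n\in\mathbb N$, $\beta\in\mathbb C$, the monic generalized Laguerre polynomial is $\widehat L_n^{(\beta)}(y)=\sum_{i=0}^n(-1)^{n+i}\binom ni(\beta+i+1)_{n-i}y^i$. Set $\psi_\pm^{(\beta)}(n,x)=e^{-x^2/2}x^{\frac12\pm\beta}\widehat L_n^{(\pm\beta)}(x^2)$. $\mathscr V_r=\{(m_1,\dots,m_r)\in\mathbb N^r: m_1>m_2>\dots>m_r\}$, and $|\boldsymbol v|=\sum_iv_i$. $\Psi^{(\beta)}_{\boldsymbol m,\boldsymbol n}(x)$ denotes the Wronskian determinant $\det(\partial_x^{a-1}f_b)_{a,b=1}^{r+s}$ of the functions $f_1,\dots,f_{r+s}$ equal to $\psi_+^{(\beta)}(m_1,x),\dots,\psi_+^{(\beta)}(m_r,x),\psi_-^{(\beta)}(n_1,x),\dots,\psi_-^{(\beta)}(n_s,x)$. For a vector $\boldsymbol v=(v_1,\dots,v_k)$, $\Delta(\boldsymbol v)=\prod_{1\le i<j\le k}(v_j-v_i)$, and $\kappa^{(\beta)}_{\boldsymbol m,\boldsymbol n}=\Delta(2m_1+\beta,\dots,2m_r+\beta,2n_1-\beta,\dots,2n_s-\beta)$. *)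

(* Defs.v *)
From HB Require Import structures.
From mathcomp Require Import all_boot all_order all_algebra.
From mathcomp Require Import complex.
From mathcomp Require Import all_classical all_reals all_analysis.
Set Implicit Arguments. Unset Strict Implicit. Unset Printing Implicit Defensive.
Import Order.TTheory GRing.Theory Num.Theory.
Local Open Scope ring_scope.
Local Open Scope complex_scope.

Definition poch (F : pzRingType) (z : F) (m : nat) : F :=
  \prod_(j < m) (z + j%:R).

(* rising Pochhammer symbol with integer index (standard extension
   (z)_{-k} = 1 / ((z-1)(z-2)...(z-k)), i.e. Gamma(z+m)/Gamma(z)) *)
Definition pochZ (F : fieldType) (z : F) (m : int) : F :=
  match m with
  | Posz k => poch z k
  | Negz k => (\prod_(j < k.+1) (z - (j.+1)%:R))^-1
  end.

Section Analytic.
Variable R : realType.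

(* x^w = exp(w ln x) for real x > 0 and complex w *)
Definition cpow (x : R) (w : R[i]) : R[i] :=
  (expR (complex.Re w * ln x) * cos (complex.Im w * ln x)) +i*
  (expR (complex.Re w * ln x) * sin (complex.Im w * ln x)).

Definition cderivn (k : nat) (f : R -> R[i]) (x : R) : R[i] :=
  (derive1n k (fun t : R => complex.Re (f t) : R^o) x) +i*
  (derive1n k (fun t : R => complex.Im (f t) : R^o) x).

(* monic generalized Laguerre polynomial \hat L_n^{(b)}(y) *)
Definition laguerre (b : R[i]) (n : nat) (y : R[i]) : R[i] :=
  \sum_(i < n.+1) (-1) ^+ (n + i) * ('C(n, i))%:R
                  * poch (b + (i.+1)%:R) (n - i) * y ^+ i.

Definition psi (sg : bool) (b : R[i]) (n : nat) (x : R) : R[i] :=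
  let b' := if sg then b else - b in
  (expR (- (x ^+ 2) / 2))%:C * cpow x (2^-1 + b') * laguerre b' n (x ^+ 2)%:C.

Definition psi_family (r s : nat) (m : 'I_r -> nat) (n : 'I_s -> nat)
  (b : R[i]) (c : 'I_(r + s)) : R -> R[i] :=
  match fintype.split c with
  | inl i => psi true b (m i)
  | inr j => psi false b (n j)
  end.

Definition Psi (r s : nat) (m : 'I_r -> nat) (n : 'I_s -> nat)
  (b : R[i]) (x : R) : R[i] :=
  \det (\matrix_(a < r + s, c < r + s) cderivn a (psi_family m n b c) x).

End Analytic.

Definition Delta (F : pzRingType) (k : nat) (v : 'I_k -> F) : F :=
  \prod_(i < k) \prod_(j < k | (i < j)%N) (v j - v i).

Definition kappa (F : pzRingType) (r s : nat) (m : 'I_r -> nat)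
  (n : 'I_s -> nat) (b : F) : F :=
  Delta (fun c : 'I_(r + s) => match fintype.split c with
                               | inl i => 2 * (m i)%:R + b
                               | inr j => 2 * (n j)%:R - b
                               end).

Definition evalZ2 (F : comNzRingType) (Phi : {poly {poly int}}) (b y : F) : F :=
  \sum_(k < size Phi) (map_poly intr Phi`_k).[b] * y ^+ k.

Definition rho (pm : bool) (r s : nat) (m : 'I_r -> nat) (n : 'I_s -> nat)
  (k : nat) : rat :=
  (\sum_(i < r) ((m i) ^ k)%N%:R) +
  (if pm then 1 else -1) * (\sum_(j < s) ((n j) ^ k)%N%:R).

Definition dimPhi (r s : nat) (m : 'I_r -> nat) (n : 'I_s -> nat) : nat :=
  ((\sum_(i < r) m i + \sum_(j < s) n j) - 'C(r, 2) - 'C(s, 2))%N.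

(* Main.v *)
Require Import Defs.
From HB Require Import structures.
From mathcomp Require Import all_boot all_order all_algebra.
From mathcomp Require Import perm complex ring zify.
From mathcomp Require Import all_classical all_reals all_analysis.
Set Implicit Arguments. Unset Strict Implicit. Unset Printing Implicit Defensive.
Import Order.TTheory GRing.Theory Num.Theory.
Import numFieldNormedType.Exports.
Local Open Scope ring_scope.
Local Open Scope complex_scope.

(** In the variable [z = 1 / x^2] the functions of the family become rows
    [D^a p] of polynomials, with [D = E - 2 z d/dz], where
    [E = 2 k + b] or [E = 2 k - b] is the eigenvalue attached to the label
    [(true, k)] or [(false, k)]; up to an elementary factor the Wronskian is
    [tau = det (D^a p_c)], whose constant term is the Vandermonde determinant
    [kap] of the eigenvalues.  The second order equation satisfied by the [p_c]
    gives the Darboux-Crum identity, for a family [T] of [N] labels and two more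
    labels [g] and [h],
      [(E_h - E_g) tau_Tg tau_Th = (1 + N z - z (E_g + E_h) / 2) tau_T tau_Tgh
                                   + z^2 (tau_T tau_Tgh' - tau_T' tau_Tgh)].
    Written for the quotients [Phi = tau / kap] it has no denominators, so if
    [Phi_T] and [Phi_Tgh] have coefficients in [Z[b]] then so has the product
    [Phi_Tg Phi_Th], and Gauss' lemma applies to both factors.  Choosing [g]
    beyond the staircase and [h] a gap below it, this is an induction on the
    degree.  The same identity, read on the coefficients of [z], [z^2] and
    [z^d], determines the three explicit coefficients by induction on the number
    of labels. *)

(** * Determinants and the Darboux-Crum identity *)

(** The obstacle is arithmetic. For two labels of the same sign the factor of [kap] is an integer,
    so vanishing at special values of [b] can account only for the linear factors of [kap];
    divisibility of [tau] by all of [kap] over [Z[b]] needs the Gauss step. That step controls the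
    content because the constant terms of the two polynomials multiply to exactly the constant that
    divides their product. One identity covers both families because the differential equation sees
    the sign of a label only through its eigenvalue: the other coefficients contain [b ^+ 2] alone.
    Multiplication by an eigenvalue is therefore the action of a single banded matrix on the rows,
    whatever the label. The inverse variable [z] exchanges the two ends of the polynomial: monicity
    becomes a statement on the constant term, where the Vandermonde determinant is visible at
    once. *)

Lemma det_schur (K : comNzRingType) (n k : nat) (A : 'M[K]_n) (B : 'M[K]_(n, k))
    (C : 'M[K]_(k, n)) (D : 'M[K]_k) :
  \det A ^+ k * \det (block_mx A B C D)
  = \det A * \det (\det A *: D - C *m \adj A *m B).
Proof.
(* A block elimination without division: the lower rows are scaled by [\det A], which is what costs
   the factor [\det A ^+ k]. *)
have E : block_mx 1%:M 0 (- (C *m \adj A)) (\det A)%:M *m block_mx A B C D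
       = block_mx A B 0 (\det A *: D - C *m \adj A *m B).
  rewrite mulmx_block !mul1mx !mul0mx !addr0 !mulNmx !mul_scalar_mx.
  by rewrite -[C *m \adj A *m A]mulmxA mul_adj_mx mul_mx_scalar addNr addrC.
have := congr1 determinant E; rewrite det_mulmx det_ublock det_lblock det1 mul1r.
by rewrite det_scalar.
Qed.

Lemma deriv_prod_ord (K : comNzRingType) n (F : 'I_n -> {poly K}) :
  deriv (\prod_i F i)
  = \sum_i \prod_j (if j == i then deriv (F j) else F j).
Proof.
elim: n F => [|n IHn] F; first by rewrite !big_ord0 derivC.
rewrite big_ord_recl derivM IHn big_ord_recl big_ord_recl eqxx; congr (_ + _).
rewrite mulr_sumr; apply: eq_bigr => i _; rewrite big_ord_recl /=; congr (_ * _).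
Qed.

(** Jacobi's formula: the derivative hits one row at a time, and expansion along that row pairs it
    with its cofactors. It will turn the trace in [wronsk1] into a [z]-derivative of [tau]. *)
Lemma deriv_det (K : comNzRingType) n (M : 'M[{poly K}]_n) :
  deriv (\det M) = \tr (map_mx (@deriv K) M *m \adj M).
Proof.
have sgnE (e : bool) (p : {poly K}) :
    deriv ((-1) ^+ e * p) = (-1) ^+ e * deriv p.
  by case: e; rewrite ?expr1 ?expr0 ?mulN1r ?mul1r ?derivN.
pose Mi i := \matrix_(a, c) (if a == i then deriv (M a c) else M a c).
transitivity (\sum_i \det (Mi i)).
  rewrite /determinant raddf_sum exchange_big /=; apply: eq_bigr => p _.
  rewrite sgnE deriv_prod_ord mulr_sumr; apply: eq_bigr => i _.
  by congr (_ * _); apply: eq_bigr => j _; rewrite !mxE.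
apply: eq_bigr => i _; rewrite (expand_det_row _ i) mxE; apply: eq_bigr => j _.
rewrite !mxE eqxx; congr (_ * _); rewrite /cofactor; congr (_ * \det _).
by apply/matrixP => a c; rewrite !mxE eq_sym (negPf (neq_lift _ _)).
Qed.

Section Bilinear.
Variables (K : idomainType) (L : Type) (v : nat -> L -> K) (ev : L -> K).
Variables (Cm : nat -> nat -> K) (x : K).
(** The abstract form of a second order equation: one matrix [Cm], common to all labels, realises
    multiplication by the eigenvalue on the rows and reaches at most two rows further. *)
Hypothesis Cm_top : forall a, Cm a a.+2 = x.
Hypothesis Cm_gt : forall a i, (a.+2 < i)%N -> Cm a i = 0.
Hypothesis Cm_eig : forall l a n, (a.+2 < n)%N ->
  ev l * v a l = \sum_(i < n) Cm a i * v i l.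

Definition gram n (rw : 'I_n -> nat) (t : 'I_n -> L) : 'M[K]_n :=
  \matrix_(a, c) v (rw a) (t c).

Definition wronsk n (t : 'I_n -> L) : K := \det (gram val t).

(** The derivative of the Wronskian: the sum over the rows of the determinants in which that row is
    replaced by the next one. *)
Definition wronsk1 n (t : 'I_n -> L) : K :=
  \tr (gram (fun a => a.+1) t *m \adj (gram val t)).

Section Darboux.
Variables (N : nat) (t : 'I_N -> L).
Let A := gram val t.
Let rowv i : 'rV_N := \row_c v i (t c).
Let colv b : 'cV_N := \col_a v a b.
(** The determinant of [A] bordered by row [i] and column [b], in Schur complement form
    ([det_border]). For [i = N] it is the Wronskian of the family enlarged by [b]. *)
Let P i b := \det A * v i b - (rowv i *m \adj A *m colv b) 0 0.
Let alpha := rowv N *m \adj A.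

Lemma rowv_lt (a : 'I_N) : rowv a = row a A.
Proof. by apply/rowP => c; rewrite !mxE. Qed.

Lemma P_lt (a : 'I_N) b : P a b = 0.
Proof.
rewrite /P rowv_lt -row_mul mul_mx_adj -row_mul mul_scalar_mx !mxE.
by rewrite subrr.
Qed.

Lemma P_mem i c : P i (t c) = 0.
Proof.
rewrite /P; have -> : (rowv i *m \adj A *m colv (t c)) 0 0 = (rowv i *m \adj A *m A) 0 c.
  by rewrite [LHS]mxE [RHS]mxE; apply: eq_bigr => a _; congr (_ * _); rewrite !mxE.
by rewrite -mulmxA mul_adj_mx mul_mx_scalar !mxE subrr.
Qed.

(** The correction term of [P] sees row [i] only through its values on the family [t], so it
    disappears from any combination of rows that vanishes there. *)
Lemma P_comb (n : nat) (u : 'I_n -> K) b :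
    (forall c, \sum_i u i * v i (t c) = 0) ->
  \det A * \sum_i u i * v i b = \sum_i u i * P i b.
Proof.
move=> u0; rewrite mulr_sumr.
have Z : \sum_i u i * (rowv i *m (\adj A *m colv b)) 0 0 = 0.
  under eq_bigr => i _ do rewrite mxE mulr_sumr.
  rewrite exchange_big big1 // => c _.
  under eq_bigr => i _ do rewrite !mxE mulrA.
  by rewrite -mulr_suml u0 mul0r.
rewrite -[LHS]subr0 -[X in _ - X]Z -sumrB; apply: eq_bigr => i _.
by rewrite /P mulmxA mulrBr; congr (_ - _); rewrite mulrCA.
Qed.

Let wt (i : nat) : K := \det A * Cm N i - \sum_(a < N) alpha 0 a * Cm a i.

(** The Darboux-transformed equation. The product [ev b * P N b] is a combination of rows with
    weights [wt]; it vanishes on the family because [P N] does, so [P_comb] rewrites it in terms of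
    [P], and the rows below [N] drop out by [P_lt]. *)
Lemma P_eig b : \det A * (ev b * P N b)
  = wt N * P N b + wt N.+1 * P N.+1 b + wt N.+2 * P N.+2 b.
Proof.
have wtE l : ev l * P N l = \sum_(i < N.+3) wt i * v i l.
  rewrite /P mulrBr mulrCA (@Cm_eig l N N.+3) // mulr_sumr.
  rewrite -/alpha [(alpha *m _) 0 0]mxE mulr_sumr.
  have -> : \sum_a ev l * (alpha 0 a * colv l a 0) =
            \sum_(i < N.+3) (\sum_(a < N) alpha 0 a * Cm a i) * v i l.
    under eq_bigr => a _.
      rewrite [colv l a 0]mxE mulrCA (@Cm_eig l a N.+3) ?mulr_sumr; last first.
        by rewrite !ltnS ltnW // ltnW // ltn_ord.
      over.
    rewrite exchange_big; apply: eq_bigr => i _.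
    by rewrite mulr_suml; apply: eq_bigr => a _; rewrite mulrA.
  rewrite -sumrB; apply: eq_bigr => i _; rewrite /wt mulrBl mulrA //.
rewrite wtE P_comb; last by move=> c; rewrite -wtE P_mem mulr0.
rewrite !big_ord_recr /= big1 ?add0r // => i _.
by rewrite (P_lt i) mulr0.
Qed.

(** Replacing a row other than the last repeats a row of [A], which gives an off-diagonal entry of
    [A *m \adj A]. The condition [a.+1 == N] names the last row and also makes sense for [N = 0]. *)
Lemma wronsk1_alpha : wronsk1 t = \sum_(a < N | a.+1 == N) alpha 0 a.
Proof.
rewrite /wronsk1 /mxtrace (bigID (fun a : 'I_N => a.+1 == N)) /= [X in _ + X]big1 ?addr0.
  apply: eq_bigr => a /eqP aN; rewrite !mxE; apply: eq_bigr => c _.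
  by rewrite !mxE aN.
move=> a aN; have ltN : (a.+1 < N)%N by rewrite ltn_neqAle aN ltn_ord.
have -> : (gram (fun i => i.+1) t *m \adj A) a a = (A *m \adj A) (Ordinal ltN) a.
  by rewrite !mxE; apply: eq_bigr => c _; rewrite !mxE.
by rewrite mul_mx_adj mxE -val_eqE /= gtn_eqF.
Qed.

Lemma wt_top : wt N.+2 = \det A * x.
Proof.
by rewrite /wt Cm_top big1 ?subr0 // => a _; rewrite Cm_gt ?mulr0 // !ltnS ltn_ord.
Qed.

Lemma wt_subtop : wt N.+1 = \det A * Cm N N.+1 - x * wronsk1 t.
Proof.
rewrite /wt wronsk1_alpha mulr_sumr; congr (_ - _).
rewrite (bigID (fun a : 'I_N => a.+1 == N)) /= [X in _ + X]big1 ?addr0.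
  by apply: eq_bigr => a /eqP aN; rewrite -[X in Cm a X.+1]aN Cm_top mulrC.
by move=> a aN; rewrite Cm_gt ?mulr0 // !ltnS ltn_neqAle aN ltn_ord.
Qed.


Hypothesis detA : \det A != 0.

Lemma det_border i b (M : 'M[K]_(N + 1)) :
    M = block_mx A (colv b) (rowv i) (v i b)%:M ->
  \det M = P i b.
Proof.
move=> ->; apply: (mulfI detA); rewrite -[X in X * _ = _]expr1 det_schur.
by rewrite det_mx11 /P !mxE eqxx mulr1n.
Qed.

(** Sylvester's identity: the Schur complement of size two is the matrix of the singly bordered
    determinants, and one factor [\det A] cancels. *)
Lemma det_border2 i j g h (M : 'M[K]_(N + 2)) :
    M = block_mx A (\matrix_(a, c) v a (if c == 0 then g else h))
      (\matrix_(a, c) v (if a == 0 then i else j) (t c))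
      (\matrix_(a, c) v (if a == 0 then i else j) (if c == 0 then g else h)) ->
  \det A * \det M = P i g * P j h - P i h * P j g.
Proof.
move=> ->; apply: (mulfI detA); rewrite mulrA -expr2 det_schur; congr (_ * _).
set S := (X in \det X).
have -> : S = \matrix_(a, c) P (if a == 0 then i else j) (if c == 0 then g else h).
  apply/matrixP => a c; rewrite mxE /S /P !mxE; congr (_ - _).
  apply: eq_bigr => e _; rewrite !mxE; congr (_ * _).
  by apply: eq_bigr => f _; rewrite !mxE.
rewrite (expand_det_row _ ord0) !big_ord_recl big_ord0 addr0 /cofactor !det_mx11 !mxE /=.
by rewrite expr0 expr1 mul1r mulN1r mulrN.
Qed.

(** Each of the two relations [P_eig] is multiplied by the other label's [P N] and the results are
    subtracted: [wt N] disappears and only two-by-two minors remain, which are doubly bordered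
    determinants with rows [N], [N.+1] for [tgh] and [N], [N.+2] for [tgh1]. *)
Lemma P_darboux (g h : L) (tgh tgh1 : K) :
    \det A * tgh = P N g * P N.+1 h - P N h * P N.+1 g ->
    \det A * tgh1 = P N g * P N.+2 h - P N h * P N.+2 g ->
  (ev g - ev h) * (P N g * P N h)
  = - Cm N N.+1 * \det A * tgh + x * wronsk1 t * tgh - x * \det A * tgh1.
Proof.
move=> E0 E1; apply: (mulfI detA).
have -> : \det A * ((ev g - ev h) * (P N g * P N h)) =
   \det A * (ev g * P N g) * P N h - \det A * (ev h * P N h) * P N g by ring.
rewrite !P_eig.
transitivity (wt N.+2 * (P N.+2 g * P N h - P N.+2 h * P N g)
   + wt N.+1 * (P N.+1 g * P N h - P N.+1 h * P N g)); first by ring.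
have -> : P N.+1 g * P N h - P N.+1 h * P N g = - (\det A * tgh) by rewrite E0; ring.
have -> : P N.+2 g * P N h - P N.+2 h * P N g = - (\det A * tgh1) by rewrite E1; ring.
by rewrite wt_top wt_subtop; ring.
Qed.

End Darboux.

Variable x0 : L.

Definition wr (s : seq L) : K := wronsk (fun i : 'I_(size s) => nth x0 s i).
Definition wr1 (s : seq L) : K := wronsk1 (fun i : 'I_(size s) => nth x0 s i).

(** The free [n] lets the size of an extended list be read as [N + 1] or [N + 2], as the block
    matrices require. *)
Lemma wrE n s : size s = n -> wr s = \det (\matrix_(a < n, c < n) v a (nth x0 s c)).
Proof. by move=> <-. Qed.

Lemma wr1E n s : size s = n -> (0 < n)%N -> wr1 s =
  \det (\matrix_(a < n, c < n) v (if a.+1 == n :> nat then n else a) (nth x0 s c)).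
Proof.
move=> sz; rewrite /wr1; move: (nth x0 s) => l.
move: (size s) sz => _ -> {s}; case: n => // n _; rewrite wronsk1_alpha.
rewrite (big_pred1 ord_max); last by move=> a; rewrite /= eqSS -val_eqE.
rewrite (expand_det_row _ ord_max) !mxE; apply: eq_bigr => c _.
rewrite !mxE /= eqxx; congr (_ * _); rewrite /cofactor; congr (_ * \det _).
apply/matrixP => i j; rewrite !mxE ifN // eqSS.
by rewrite -[X in _ == X]/(val (@ord_max n)) val_eqE eq_sym neq_lift.
Qed.

Lemma wr_darboux T g h : wr T != 0 ->
  (ev g - ev h) * (wr (rcons T g) * wr (rcons T h))
  = - Cm (size T) (size T).+1 * wr T * wr (rcons (rcons T g) h)
    + x * wr1 T * wr (rcons (rcons T g) h)
    - x * wr T * wr1 (rcons (rcons T g) h).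
Proof.
move=> T0; set N := size T.
have sz1 y : size (rcons T y) = (N + 1)%N by rewrite size_rcons addn1.
have sz2 : size (rcons (rcons T g) h) = (N + 2)%N by rewrite !size_rcons addn2.
have nthT (i : 'I_N) y : nth x0 (rcons T y) i = nth x0 T i.
  by rewrite nth_rcons ltn_ord.
have nthT2 (i : 'I_N) : nth x0 (rcons (rcons T g) h) i = nth x0 T i.
  by rewrite nth_rcons size_rcons ltnS ltnW // nthT.
have nth2 (i : 'I_2) : nth x0 (rcons (rcons T g) h) (N + i) = if i == 0 then g else h.
  case: i => -[|[|//]] p /=; rewrite ?addn0 ?addn1 nth_rcons size_rcons.
    by rewrite ltnSn nth_rcons ltnn eqxx.
  by rewrite ltnn eqxx.
rewrite (wrE (sz1 g)) (wrE (sz1 h)) !(wrE sz2) (wr1E sz2); last by rewrite addn2.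
rewrite -[wr T]/(\det (gram val (fun i : 'I_N => nth x0 T i))) -[wr1 T]/(wronsk1 _).
have B y : \matrix_(a < N + 1, c < N + 1) v a (nth x0 (rcons T y) c) =
  block_mx (gram val (fun i : 'I_N => nth x0 T i)) (\col_a v a y)
    (\row_c v N (nth x0 T c)) (v N y)%:M.
  apply/matrixP => i j; rewrite mxE -(splitK i) -(splitK j).
  case: (fintype.split i) => a; case: (fintype.split j) => c /=.
  - by rewrite block_mxEul !mxE nthT.
  - by rewrite block_mxEur !mxE (ord1 c) /= addn0 nth_rcons ltnn eqxx.
  - by rewrite block_mxEdl !mxE (ord1 a) /= addn0 nthT.
  - by rewrite block_mxEdr !mxE (ord1 a) (ord1 c) /= addn0 nth_rcons ltnn eqxx mulr1n.
rewrite (det_border T0 (B g)) (det_border T0 (B h)).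
apply: P_darboux => //.
  apply: (det_border2 T0); apply/matrixP => i j; rewrite mxE -(splitK i) -(splitK j).
  case: (fintype.split i) => a; case: (fintype.split j) => c /=.
  - by rewrite block_mxEul !mxE nthT2.
  - by rewrite block_mxEur !mxE nth2.
  - rewrite block_mxEdl !mxE nthT2; congr (v _ _).
    by case: a => -[|[|//]] p; rewrite /= ?addn0 ?addn1.
  - rewrite block_mxEdr !mxE nth2; congr (v _ _).
    by case: a => -[|[|//]] p; rewrite /= ?addn0 ?addn1.
(* In [wr1] the last of the [N + 2] rows is replaced by row [N.+2], so the border rows are now [N]
   and [N.+2]. *)
apply: (det_border2 T0); apply/matrixP => i j; rewrite mxE -(splitK i) -(splitK j).
case: (fintype.split i) => a; case: (fintype.split j) => c /=.
- by rewrite block_mxEul !mxE nthT2 addn2 ltn_eqF // !ltnS ltnW.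
- by rewrite block_mxEur !mxE nth2 addn2 ltn_eqF // !ltnS ltnW.
- rewrite block_mxEdl !mxE nthT2; congr (v _ _).
  case: a => -[|[|//]] p; rewrite /= ?addn0 ?addn1 ?addn2 ?eqxx //.
  by rewrite ltn_eqF.
- rewrite block_mxEdr !mxE nth2; congr (v _ _).
  case: a => -[|[|//]] p; rewrite /= ?addn0 ?addn1 ?addn2 ?eqxx //.
  by rewrite ltn_eqF.
Qed.

End Bilinear.

(** * Laguerre rows *)

Notation lab := (bool * nat)%type.
Local Notation bX := ('X : {poly int}).
Local Notation bF := (tofrac bX).
Local Notation l0 := (true, 0%N).

Section LaguerreRows.
Variables (F : comNzRingType) (b : F).

Definition sgb (sg : bool) : F := if sg then b else - b.
Definition eig (l : lab) : F := 2 * l.2%:R + sgb l.1.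
Definition lagc (l : lab) (j : nat) : F :=
  (-1) ^+ j * 'C(l.2, j)%:R * poch (sgb l.1 + (l.2 - j).+1%:R) j.
(* The coefficients are listed from the top: [lagc l j] is the coefficient of
   [y ^ (k - j)] in the monic Laguerre polynomial of label [l = (_, k)], so that
   [vrow] is a polynomial in [z = 1 / y]. *)
Definition vrow (a : nat) (l : lab) : {poly F} :=
  \poly_(j < l.2.+1) ((eig l - 2 * j%:R) ^+ a * lagc l j).

Lemma lagc_gt l j : (l.2 < j)%N -> lagc l j = 0.
Proof. by move=> h; rewrite /lagc bin_small // mulr0 mul0r. Qed.

Lemma coef_vrow a l j : (vrow a l)`_j = (eig l - 2 * j%:R) ^+ a * lagc l j.
Proof. by rewrite coef_poly ltnS; case: leqP => // h; rewrite lagc_gt ?mulr0. Qed.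

Lemma coefX_deriv (p : {poly F}) j : ('X * deriv p)`_j = j%:R * p`_j.
Proof. by rewrite coefXM; case: j => [|j]; rewrite ?mul0r //= coef_deriv mulr_natl. Qed.

Lemma vrowS a l : vrow a.+1 l = eig l *: vrow a l - 2 *: ('X * deriv (vrow a l)).
Proof.
apply/polyP => j; rewrite coefB !coefZ coefX_deriv !coef_vrow exprS; ring.
Qed.

Lemma pochS (z : F) m : poch z m.+1 = z * poch (z + 1) m.
Proof.
rewrite /poch big_ord_recl addr0; congr (_ * _); apply: eq_bigr => i _.
by rewrite -addrA nat1r.
Qed.

Lemma lagcS l j : j.+1%:R * lagc l j.+1
  = - ((l.2 - j)%:R * (sgb l.1 + (l.2 - j)%:R) * lagc l j).
Proof.
have [lj|jl] := leqP l.2 j.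
  by rewrite (lagc_gt (_ : (l.2 < j.+1)%N)) // (eqP (_ : (l.2 - j == 0)%N)) //
     mul0r mul0r oppr0 mulr0.
rewrite /lagc pochS subnSK //.
have -> : sgb l.1 + (l.2 - j)%:R + 1 = sgb l.1 + (l.2 - j).+1%:R by rewrite -addrA natr1.
have := congr1 (fun k : nat => k%:R : F) (mul_bin_left l.2 j); rewrite !natrM exprS => E.
set p := poch _ _; set e := (-1) ^+ j.
transitivity (- (e * (sgb l.1 + (l.2 - j)%:R) * p * (j.+1%:R * 'C(l.2, j.+1)%:R))); first by ring.
by rewrite E; ring.
Qed.

(** The shifted eigenvalue is [2 * (l.2 - j)] plus [b] or minus [b], and both signs have the same
    square. This is where the two families acquire a common equation. *)
Lemma eig_sub l j : (j <= l.2)%N ->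
  (eig l - 2 * j%:R) ^+ 2 - b ^+ 2 = 4 * ((l.2 - j)%:R * (sgb l.1 + (l.2 - j)%:R)).
Proof. by move=> h; rewrite /eig /sgb natrB //; case: l.1; ring. Qed.

(** Laguerre's equation in the variable [z]; coefficient by coefficient it is the recursion
    [lagcS]. *)
Lemma vrow_ode l : (2 * eig l) *: vrow 0 l
  = - ('X * vrow 2 l) + 2 *: vrow 1 l + (b ^+ 2) *: ('X * vrow 0 l).
Proof.
apply/polyP => -[|j]; rewrite !coefD coefN !coefZ !coefXM /= !coef_vrow !expr1 !expr0.
  by rewrite !mulr0 subr0; ring.
have [jl|lj] := leqP j l.2; last first.
  by rewrite !(lagc_gt lj) (lagc_gt (leqW lj)); ring.
transitivity (2 * (eig l - 2 * j.+1%:R) * lagc l j.+1 + 4 * (j.+1%:R * lagc l j.+1)); first by ring.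
have := eig_sub jl => /(congr1 (fun y => y * lagc l j)) E.
rewrite lagcS.
transitivity (2 * (eig l - 2 * j.+1%:R) * lagc l j.+1 - 
  4 * ((l.2 - j)%:R * (sgb l.1 + (l.2 - j)%:R)) * lagc l j); first by ring.
by rewrite -E; ring.
Qed.

(** The coefficients of [vrow_ode] after [a] applications of [D]. By the Leibniz rule either the row
    index goes up by one or the coefficient is hit by [-2 z d/dz]. *)
Fixpoint Cmx (a i : nat) : {poly F} :=
  match a with
  | 0 => match i with 0 => (b ^+ 2) *: 'X | 1 => 2 | 2 => - 'X | _ => 0 end
  | a'.+1 => (if i is i'.+1 then Cmx a' i' else 0) - 2 *: ('X * deriv (Cmx a' i))
  end.

Lemma Cmx_gt a i : (a.+2 < i)%N -> Cmx a i = 0.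
Proof.
elim: a i => [|a IHa] i; first by case: i => [|[|[]]].
by case: i => // i ai /=; rewrite !IHa // ?derivC ?mulr0 ?scaler0 ?subr0 // ltnW.
Qed.

Lemma Cmx_top a : Cmx a a.+2 = - 'X.
Proof.
elim: a => //= a ->; rewrite Cmx_gt // derivC mulr0 scaler0 subr0 //.
Qed.

Lemma Cmx_subtop a : Cmx a a.+1 = 2 + (2 * a%:R) *: 'X.
Proof.
elim: a => [|a IHa]; first by rewrite /= mulr0 scale0r addr0.
rewrite [LHS]/= -/Cmx IHa (Cmx_top a) derivN derivX mulrN1 scalerN opprK -addrA -scalerDl.
by congr (_ + _ *: _); rewrite -natr1; ring.
Qed.

Lemma Cmx_eig l a n : (a.+2 < n)%N ->
  (2 * eig l)%:P * vrow a l = \sum_(i < n) Cmx a i * vrow i l.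
Proof.
elim: a n => [|a IHa] n an.
  case: n an => [|[|[|n]]] // _; rewrite !big_ord_recl big1 /= => [|i _]; last first.
    by rewrite mul0r.
  rewrite mul_polyC vrow_ode addr0 -!scalerAl -[2 in LHS]/(2%:R) scaler_nat -mulr_natl.
  by rewrite mulNr; ring.
rewrite vrowS mulrBr.
transitivity (eig l *: ((2 * eig l)%:P * vrow a l)
   - 2 *: ('X * deriv ((2 * eig l)%:P * vrow a l))).
  rewrite derivM derivC mul0r add0r -!mul_polyC; ring.
case: n an => // n an; rewrite (IHa n.+1); last exact: ltnW.
rewrite [deriv (\sum_(i < _) _)]raddf_sum mulr_sumr !scaler_sumr -sumrB.
under eq_bigr => i _.
  rewrite (_ : _ - _ = Cmx a i * vrow i.+1 l - 2 *: ('X * deriv (Cmx a i)) * vrow i l).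
    over.
  by rewrite vrowS /= derivM -!mul_polyC; ring.
rewrite sumrB [X in X - _]big_ord_recr /= (Cmx_gt (_ : a.+2 < n)%N) // mul0r addr0.
under [in RHS]eq_bigr do rewrite /= mulrBl.
by rewrite sumrB [X in _ = X - _]big_ord_recl mul0r add0r.
Qed.

End LaguerreRows.

(** * The determinant [tau] and its bilinear identity *)

Section Tau.
Variables (F : comNzRingType) (b : F).

Definition tau (s : seq lab) : {poly F} :=
  \det (\matrix_(a < size s, c < size s) vrow b a (nth (true, 0%N) s c)).

Lemma tauE n s : size s = n ->
  tau s = \det (\matrix_(a < n, c < n) vrow b a (nth (true, 0%N) s c)).
Proof. by move=> <-. Qed.

End Tau.

Section TauDarboux.
Variables (F : idomainType) (b : F).
Local Notation tau := (tau b).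
Local Notation eig := (eig b).

(** By [vrowS] the shifted matrix is [M] with its columns scaled by the eigenvalues, minus [2 z]
    times the entrywise derivative of [M]. The first part has trace the sum of the eigenvalues times
    [tau]; the second is Jacobi's formula. *)
Lemma wr1_tau s : wr1 (vrow b) (true, 0%N) s
  = (\sum_(l <- s) eig l)%:P * tau s - 2%:P * 'X * deriv (tau s).
Proof.
rewrite /wr1 /wronsk1.
set t := fun i : 'I_(size s) => nth (true, 0%N) s i.
set M := gram (vrow b) val t.
have -> : gram (vrow b) (fun a => a.+1) t =
    M *m diag_mx (\row_c (eig (t c))%:P) - (2%:P * 'X) *: map_mx (@deriv F) M.
  apply/matrixP => i j; rewrite mul_mx_diag !mxE vrowS -!mul_polyC mulrA.
  by rewrite [_%:P * vrow _ _ _]mulrC.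
rewrite mulmxBl raddfB /= -scalemxAl linearZ /= -deriv_det; congr (_ - _).
rewrite -mulmxA mxtrace_mulC -mulmxA mul_adj_mx mul_mx_scalar linearZ /= mxtrace_diag.
rewrite mulrC; congr (_ * _).
rewrite (big_nth (true, 0%N)) big_mkord rmorph_sum.
by apply: eq_bigr => i _; rewrite mxE.
Qed.

(** In the difference of the two [wr1] terms the eigenvalues of [T] cancel, leaving those of [g] and
    [h]. The factor 2 on the left is the one in [Cmx_eig]. *)
Lemma tau_darboux T g h : tau T != 0 ->
  (2 * (eig h - eig g))%:P * (tau (rcons T g) * tau (rcons T h))
  = (2 + (2 * (size T)%:R) *: 'X) * (tau T * tau (rcons (rcons T g) h))
    - 'X * ((eig g + eig h)%:P * (tau T * tau (rcons (rcons T g) h))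
            - 2%:P * 'X * (tau T * deriv (tau (rcons (rcons T g) h))
                           - deriv (tau T) * tau (rcons (rcons T g) h))).
Proof.
move=> T0; have := @wr_darboux _ _ (vrow b) (fun l => (2 * eig l)%:P) (Cmx b) (- 'X)
  (@Cmx_top _ b) (@Cmx_gt _ b) (@Cmx_eig _ b) (true, 0%N) T g h T0.
rewrite !wr1_tau Cmx_subtop -!cats1 !big_cat !big_seq1 !cats1.
rewrite -[wr _ _ T]/(tau T) -[wr _ _ (rcons T g)]/(tau (rcons T g)).
rewrite -[wr _ _ (rcons T h)]/(tau (rcons T h)).
rewrite -[wr _ _ (rcons (rcons T g) h)]/(tau (rcons (rcons T g) h)).
move: (tau T) (tau (rcons T g)) (tau (rcons T h)) (tau (rcons (rcons T g) h)).
move=> t tg th tgh; move: (\sum_(l <- T) _) => S /(congr1 -%R) E.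
have -> : (2 * (eig h - eig g))%:P * (tg * th) =
  - (((2 * eig g)%:P - (2 * eig h)%:P) * (tg * th)) by rewrite -polyCB; ring.
by rewrite {}E !rmorphD /=; ring.
Qed.

End TauDarboux.

(** * The constant term of [tau] and its expansion in powers of [z] *)

Section Vandermonde.
Variables (F : comNzRingType) (b : F).

Definition kap (s : seq lab) : F := Delta (fun c : 'I_(size s) => eig b (nth l0 s c)).

Lemma Delta_det n (v : 'I_n -> F) : Delta v = \det (\matrix_(a < n, c < n) v c ^+ a).
Proof.
have -> : \matrix_(a < n, c < n) v c ^+ a = Vandermonde n (\row_c v c).
  by apply/matrixP => i j; rewrite !mxE.
rewrite det_Vandermonde; apply: eq_bigr => i _; apply: eq_bigr => j _; rewrite !mxE //.
Qed.

Lemma lagc0 l : lagc b l 0 = 1.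
Proof. by rewrite /lagc bin0 /poch big_ord0 !mulr1. Qed.

Lemma tau_coef0 s : (tau b s)`_0 = kap s.
Proof.
rewrite -horner_coef0 /tau /kap Delta_det.
rewrite -[LHS]/(horner_eval 0 _) -det_map_mx; congr (\det _).
apply/matrixP => i j; rewrite !mxE /= /horner_eval horner_coef0 coef_vrow lagc0.
by rewrite mulr0 subr0 mulr1.
Qed.

Lemma kap_rcons s g : kap (rcons s g) = kap s * \prod_(l <- s) (eig b g - eig b l).
Proof.
have nl (i : 'I_(size s)) : nth l0 (rcons s g) i = nth l0 s i.
  by rewrite nth_rcons ltn_ord.
have ng : nth l0 (rcons s g) (size s) = g by rewrite nth_rcons ltnn eqxx.
rewrite /kap /Delta size_rcons big_ord_recr /= [X in _ * X]big1 ?mulr1; last first.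
  by move=> j; rewrite ltnNge -ltnS ltn_ord.
rewrite (big_nth l0) big_mkord -big_split /=; apply: eq_bigr => i _.
rewrite big_mkcond big_ord_recr /= ltn_ord ng nl.
rewrite [in RHS]big_mkcond; congr (_ * _); apply: eq_bigr => j _.
by rewrite nl.
Qed.

(** Division of [tau_darboux] by this relation removes the eigenvalue difference. *)
Lemma kap_darboux T g h :
  kap T * kap (rcons (rcons T g) h) = (eig b h - eig b g) * (kap (rcons T g) * kap (rcons T h)).
Proof. by rewrite !kap_rcons -cats1 big_cat big_seq1 /=; ring. Qed.

Lemma tau_perm s s' : perm_eq s s' -> exists e : bool, tau b s' = (-1) ^+ e * tau b s.
Proof.
move=> pss'; have szs := perm_size pss'.
have /tuple_permP [p Ep] : perm_eq s (in_tuple s') by [].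
exists (perm.odd_perm p); rewrite (tauE _ szs) /tau.
have -> : \matrix_(a < size s', c < size s') vrow b a (nth l0 s c) =
    col_perm p (\matrix_(a < size s', c < size s') vrow b a (nth l0 s' c)).
  apply/matrixP => i j; rewrite !mxE; congr vrow.
  by rewrite Ep -tnth_nth tnth_mktuple (tnth_nth l0).
rewrite col_permE det_mulmx det_perm perm.odd_permV [_ * (-1) ^+ _]mulrC mulrA.
by rewrite -expr2 sqrr_sign mul1r.
Qed.

(** Multilinearity in the columns: once a power of [z] is chosen in each column, the remaining
    determinant is a Vandermonde determinant in shifted eigenvalues. The degree bounds in [z] and in
    [b] are both read off from this sum. *)
Lemma tau_sum (s : seq lab) K : (forall l, l \in s -> (l.2 < K)%N) -> tau b s =
  \sum_(f : {ffun 'I_(size s) -> 'I_K})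
    ((\prod_(c < size s) lagc b (nth l0 s c) (f c)) *
     Delta (fun c : 'I_(size s) => eig b (nth l0 s c) - 2 * (f c)%:R))%:P
    * 'X^(\sum_(c < size s) f c).
Proof.
move=> sK; rewrite /tau -det_tr /determinant.
pose u (c : 'I_(size s)) (j : nat) := eig b (nth l0 s c) - 2 * j%:R.
have rowE (p : 'S_(size s)) : \prod_c (\matrix_(a < size s, c < size s)
    vrow b a (nth l0 s c))^T c (p c) = \sum_(f : {ffun 'I_(size s) -> 'I_K})
    \prod_c ((u c (f c) ^+ p c * lagc b (nth l0 s c) (f c))%:P * 'X^(f c)).
  rewrite -(bigA_distr_bigA (fun c (j : 'I_K) =>
     (u c j ^+ p c * lagc b (nth l0 s c) j)%:P * 'X^j)).
  apply: eq_bigr => c _; rewrite !mxE.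
  apply/polyP => j; rewrite coef_vrow coef_sum.
  under eq_bigr => i _ do rewrite coefCM coefXn.
  have [jK|Kj] := ltnP j K.
    rewrite (bigD1 (Ordinal jK)) //= eqxx mulr1 big1 ?addr0 // => i ij.
    by rewrite [j == _]eq_sym -val_eqE /= in ij *; rewrite (negPf ij) mulr0.
  rewrite lagc_gt ?mulr0 ?big1 // => [i _|].
    by rewrite gtn_eqF ?mulr0 // (leq_trans (ltn_ord i)).
  by rewrite (leq_trans _ Kj) // sK // mem_nth.
under eq_bigr => p _ do rewrite rowE mulr_sumr.
rewrite exchange_big; apply: eq_bigr => f _ /=.
rewrite Delta_det rmorphM /= mulrAC rmorph_prod -[(\det _)%:P]det_map_mx -det_tr.
rewrite mulr_sumr; apply: eq_bigr => p _.
rewrite mulrCA; congr (_ * _).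
rewrite expr_sum -!big_split /=; apply: eq_bigr => c _.
by rewrite !mxE rmorphM /=; ring.
Qed.

End Vandermonde.

(** * Change of the base ring and specialisation of [b] *)

Section Morphism.
Variables (A B : comNzRingType) (f : {rmorphism A -> B}) (b : A).

Lemma poch_map z k : f (poch z k) = poch (f z) k.
Proof. by rewrite /poch rmorph_prod; apply: eq_bigr => i _; rewrite rmorphD rmorph_nat. Qed.

Lemma sgb_map sg : f (sgb b sg) = sgb (f b) sg.
Proof. by case: sg; rewrite /sgb ?rmorphN. Qed.

Lemma eig_map l : f (eig b l) = eig (f b) l.
Proof. by rewrite /eig rmorphD rmorphM !rmorph_nat sgb_map. Qed.

Lemma lagc_map l j : f (lagc b l j) = lagc (f b) l j.
Proof. by rewrite /lagc !rmorphM rmorph_sign rmorph_nat poch_map rmorphD rmorph_nat sgb_map. Qed.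

Lemma vrow_map a l : map_poly f (vrow b a l) = vrow (f b) a l.
Proof.
apply/polyP => j; rewrite coef_map !coef_vrow /= rmorphM rmorphXn rmorphB rmorphM !rmorph_nat.
by rewrite eig_map lagc_map.
Qed.

Lemma tau_map s : map_poly f (tau b s) = tau (f b) s.
Proof.
rewrite /tau -det_map_mx; congr (\det _).
by apply/matrixP => i j; rewrite !mxE /= vrow_map.
Qed.

Lemma kap_map s : f (kap b s) = kap (f b) s.
Proof. by rewrite -!tau_coef0 -tau_map coef_map. Qed.

End Morphism.

(** * Staircases and degree bounds *)

Section Staircase.

Lemma ex_ge_size (ks : seq nat) : uniq ks -> (0 < size ks)%N ->
  exists2 g, g \in ks & (size ks <= g.+1)%N.
Proof.
move=> uks ks0; apply/hasP; apply: contraT; rewrite -all_predC => /allP /= small.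
have : (size ks <= size (iota 0 (size ks).-1))%N.
  apply: uniq_leq_size => // g /small; rewrite -ltnNge mem_iota add0n /=.
  by move=> h; rewrite -ltnS prednK.
by rewrite size_iota -ltnS prednK // ltnn.
Qed.

Lemma sum_uniq_ge (ks : seq nat) : uniq ks -> ('C(size ks, 2) <= \sum_(k <- ks) k)%N.
Proof.
move: {2}(size ks) (erefl (size ks)) => n; elim: n ks => [|n IHn] ks sz uks.
  by rewrite sz bin0n.
have [|g gks hg] := ex_ge_size uks; first by rewrite sz.
rewrite (perm_big _ (perm_to_rem gks)) big_cons sz binS bin1 addnC.
rewrite sz ltnS in hg; apply: leq_add => //.
have szr : size (rem g ks) = n by rewrite size_rem // sz.
by rewrite -szr IHn // rem_uniq.
Qed.

Lemma sum_staircase (ks : seq nat) : uniq ks -> (forall k, k \in ks -> (k < size ks)%N) ->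
  (\sum_(k <- ks) k = 'C(size ks, 2))%N.
Proof.
move=> uks small; rewrite -bin2_sum /index_iota subn0.
apply: perm_big; apply: uniq_perm => //; first exact: iota_uniq.
have sub : {subset ks <= iota 0 (size ks)} by move=> k /small; rewrite mem_iota.
by have [] := uniq_min_size uks sub _ => //; rewrite size_iota.
Qed.

(** Pigeonhole: without [g], too few elements remain to fill all the places below the size. *)
Lemma ex_gap (ks : seq nat) g : uniq ks -> g \in ks -> (size ks <= g)%N ->
  exists2 h, (h < size ks)%N & h \notin ks.
Proof.
move=> uks gks hg; pose r := iota 0 (size ks).
suff /hasP[h] : has (fun h => h \notin ks) r by rewrite mem_iota => hr hk; exists h.
apply: contraT; rewrite -all_predC => /allP /= full.
have : (size r <= size (rem g ks))%N.
  apply: uniq_leq_size; first exact: iota_uniq.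
  move=> h hr; rewrite mem_rem_uniq // inE; move/negPn: (full h hr) => ->; rewrite andbT.
  by move: hr; rewrite mem_iota => hr; apply: contraTneq hr => ->; rewrite -leqNgt.
by rewrite size_iota size_rem // -ltnS prednK ?ltnn //; case: (ks) gks.
Qed.

Definition fam (sg : bool) (s : seq lab) : seq nat := [seq l.2 | l <- s & l.1 == sg].
Definition tot (s : seq lab) : nat := \sum_(l <- s) l.2.
(** The least total of distinct labels with these family sizes, attained by two full staircases. The
    degree in [z] is measured by [tot s - low s]. *)
Definition low (s : seq lab) : nat :=
  ('C(size (fam true s), 2) + 'C(size (fam false s), 2))%N.

Lemma fam_uniq sg s : uniq s -> uniq (fam sg s).
Proof.
move=> us; rewrite map_inj_in_uniq ?filter_uniq // => -[x1 x2] [y1 y2].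
by rewrite !mem_filter /= => /andP[/eqP -> _] /andP[/eqP -> _] ->.
Qed.

Lemma mem_fam sg s k : (k \in fam sg s) = ((sg, k) \in s).
Proof.
apply/mapP/idP => [[[x1 x2]]|kl]; first by rewrite mem_filter /= => /andP[/eqP -> h] ->.
by exists (sg, k); rewrite // mem_filter /= eqxx.
Qed.

Lemma size_fam sg s : size (fam sg s) = (\sum_(l <- s) (l.1 == sg))%N.
Proof. by rewrite size_map size_filter -sum1_count big_mkcond. Qed.

Lemma tot_fam s : tot s = (\sum_(k <- fam true s) k + \sum_(k <- fam false s) k)%N.
Proof.
rewrite /tot !big_map !big_filter (bigID (fun l : lab => l.1)) /=.
by congr addn; apply: eq_bigl => l; case: l.1.
Qed.

Lemma low_le_tot s : uniq s -> (low s <= tot s)%N.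
Proof. by move=> us; rewrite tot_fam leq_add // sum_uniq_ge // fam_uniq. Qed.

Lemma perm_low s s' : perm_eq s s' -> low s = low s'.
Proof. by move=> p; rewrite /low !size_fam !(perm_big _ p). Qed.

Lemma perm_tot s s' : perm_eq s s' -> tot s = tot s'.
Proof. by move=> p; rewrite /tot (perm_big _ p). Qed.

Lemma tot_rcons s l : tot (rcons s l) = (tot s + l.2)%N.
Proof. by rewrite /tot -cats1 big_cat big_seq1. Qed.

Lemma low_rcons s l : low (rcons s l) = (low s + size (fam l.1 s))%N.
Proof.
rewrite /low !size_fam -!cats1 !big_cat !big_seq1 /= -!size_fam.
by case: l => -[] k /=; rewrite ?addn0 !addn1 binS bin1; lia.
Qed.

End Staircase.

Lemma Delta_eq0 (F : comNzRingType) n (v : 'I_n -> F) i j :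
  i != j -> v i = v j -> Delta v = 0.
Proof.
wlog ij : i j / (i < j)%N => [W nij vij|].
  case: (ltngtP i j) => [|ji|/val_inj ij]; first by move/W; apply.
    by apply: (W j i) => //; rewrite eq_sym.
  by rewrite ij eqxx in nij.
move=> _ vij; rewrite /Delta (bigD1 i) //= (bigD1 j) //= vij subrr !mul0r //.
Qed.

Section Residual.
Variables (F : comNzRingType) (b : F).

(** A shifted eigenvalue is the eigenvalue of the label lowered by [f c]. A nonzero Vandermonde
    factor forces the lowered labels to be distinct, so their total is still at least [low s]. *)
Lemma tau_term_bound (s : seq lab) (f : 'I_(size s) -> nat) :
    (\prod_(c < size s) lagc b (nth l0 s c) (f c)) *
     Delta (fun c : 'I_(size s) => eig b (nth l0 s c) - 2 * (f c)%:R) != 0 ->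
  (\sum_(c < size s) f c + low s <= tot s)%N.
Proof.
move=> nz.
have fle (c : 'I_(size s)) : (f c <= (nth l0 s c).2)%N.
  rewrite leqNgt; apply: contraNN nz => h.
  by rewrite (bigD1 c) //= lagc_gt // !mul0r.
pose res (c : 'I_(size s)) : lab := ((nth l0 s c).1, (nth l0 s c).2 - f c)%N.
have eigE (c : 'I_(size s)) : eig b (nth l0 s c) - 2 * (f c)%:R = eig b (res c).
  by rewrite /eig /= natrB //; ring.
have resI : injective res.
  move=> c c' ecc; apply: contraNeq nz => ncc; apply/eqP.
  by rewrite (Delta_eq0 ncc) ?mulr0 // !eigE ecc.
pose s' := [seq res c | c <- enum 'I_(size s)].
have us' : uniq s' by rewrite map_inj_uniq ?enum_uniq.
have szE sg : size (fam sg s') = size (fam sg s).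
  rewrite !size_fam big_map big_enum /= (big_nth l0) big_mkord.
  by apply: eq_bigr => c _.
have -> : low s = low s' by rewrite /low !szE.
suff -> : tot s = (\sum_(c < size s) f c + tot s')%N by rewrite leq_add2l low_le_tot.
rewrite /tot big_map big_enum /= (big_nth l0) big_mkord -big_split /=.
by apply: eq_bigr => c _; rewrite subnKC.
Qed.

Lemma size_tau s : uniq s -> (size (tau b s) <= (tot s - low s).+1)%N.
Proof.
move=> us; apply/leq_sizeP => j hj.
have sK l : l \in s -> (l.2 < (tot s).+1)%N.
  by move=> ls; rewrite ltnS /tot (perm_big _ (perm_to_rem ls)) big_cons leq_addr.
rewrite (tau_sum _ sK) coef_sum big1 // => f _; rewrite coefCM coefXn.
case: eqP => [jf|]; last by rewrite mulr0.
rewrite mulr1; apply: contraTeq hj => /tau_term_bound; rewrite -jf => h.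
by rewrite -ltnNge ltnS leq_subRL ?low_le_tot // addnC.
Qed.

End Residual.

(** * Gauss' lemma and integrality *)

Section Gauss.
Variable A : idomainType.

(* Primality, phrased through the residue domain: reducing the coefficients of a
   polynomial product then needs no Gauss-type combinatorics. *)
Definition prime_elt (p : A) : Prop := p != 0 /\
  exists (B : idomainType) (f : {rmorphism A -> B}),
    forall x, f x = 0 <-> exists y, x = p * y.

(** An explicit product of primes and a unit. Since [kap] comes factored, Gauss' lemma can be run
    along this factorisation, with no appeal to unique factorisation. *)
Inductive pfactored : A -> Prop :=
| pfactored_unit u : u \is a GRing.unit -> pfactored u
| pfactored_mul p c : prime_elt p -> pfactored c -> pfactored (p * c).

Lemma pfactoredM c c' : pfactored c -> pfactored c' -> pfactored (c * c').
Proof.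
elim=> [u Uu|p d pp _ IH] h; last by rewrite -mulrA; apply: pfactored_mul => //; apply: IH.
elim: h => [w Uw|p d pp _ IH]; first by apply: pfactored_unit; rewrite unitrMr.
by rewrite mulrCA; apply: pfactored_mul.
Qed.

Lemma pfactored_prod (I : Type) (r : seq I) (P : pred I) (G : I -> A) :
  (forall i, P i -> pfactored (G i)) -> pfactored (\prod_(i <- r | P i) G i).
Proof.
move=> h; apply: big_ind => //; first by apply: pfactored_unit; rewrite unitr1.
exact: pfactoredM.
Qed.

Lemma prime_elt_polyM p (U V W : {poly A}) : prime_elt p -> U * V = p%:P * W ->
  (exists U', U = p%:P * U') \/ (exists V', V = p%:P * V').
Proof.
move=> [_ [B [f fE]]] E.
have lift (Y : {poly A}) : map_poly f Y = 0 -> exists Y', Y = p%:P * Y'.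
  move=> Y0; have /choice[g gE] : forall i : nat, exists y, Y`_i = p * y.
    by move=> i; apply/fE; rewrite -coef_map Y0 coef0.
  exists (\poly_(i < size Y) g i); apply/polyP => i; rewrite coefCM coef_poly.
  by case: ltnP => h; [rewrite gE | rewrite mulr0 nth_default].
have : map_poly f (U * V) = 0.
  rewrite E rmorphM /= map_polyC /=.
  by have -> : f p = 0; [apply/fE; exists 1; rewrite mulr1 | rewrite mul0r].
by rewrite rmorphM => /eqP; rewrite mulf_eq0 => /orP[]/eqP/lift; [left|right].
Qed.

(** Each prime of [c] divides [U] or [V], and is then removed from that polynomial together with its
    constant term. The constant terms always multiply to what is left of [c], so at the end [U] has
    a unit as constant term: exactly the primes of its original constant term were taken out of
    it. *)
Lemma gauss_factor c (U V W : {poly A}) : pfactored c ->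
  U`_0 * V`_0 = c -> U * V = c%:P * W -> exists U', U = (U`_0)%:P * U'.
Proof.
move=> pc; elim: pc U V W => {c} [u Uu|p c pp _ IH] U V W.
  move=> Eu _; exists ((U`_0)^-1 *: U); rewrite mul_polyC scalerA divrr ?scale1r //.
  by move: Uu; rewrite -Eu unitrM => /andP[].
have p0 : p != 0 by case: pp.
have P0 : p%:P != 0 by rewrite polyC_eq0.
move=> E0 E; have := prime_elt_polyM pp; move=> /(_ U V (c%:P * W)).
rewrite mulrA -polyCM => /(_ E) [] [Y YE].
  have Y0 : U`_0 = p * Y`_0 by rewrite YE coefCM.
  have [| |U' U'E] := IH Y V W.
  - by apply: (mulfI p0); rewrite mulrA -Y0.
  - by apply: (mulfI P0); rewrite !mulrA -YE E polyCM.
  by exists U'; rewrite Y0 polyCM -mulrA -U'E.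
have Y0 : V`_0 = p * Y`_0 by rewrite YE coefCM.
apply: (IH U Y W).
- by apply: (mulfI p0); rewrite mulrCA -Y0.
- by apply: (mulfI P0); rewrite mulrCA -YE E polyCM mulrA.
Qed.

End Gauss.

(** * Primes of [Z[b]] and the factors of [kap] *)

Lemma prime_elt_intC (p : nat) : prime p -> prime_elt (p%:R : {poly int}).
Proof.
move=> pp; split; first by rewrite -polyC_natr polyC_eq0 pnatr_eq0 -lt0n prime_gt0.
exists {poly 'F_p}, (map_poly intr) => q; split=> [q0|[y ->]]; last first.
  rewrite rmorphM rmorph_nat -polyC_natr.
  by have := pcharf0 (pchar_Fp pp) => ->; rewrite mul0r.
have /choice[g gE] : forall i : nat, exists y, q`_i = p%:R * y.
  move=> i; have : (p %| q`_i)%Z.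
    by rewrite (dvdz_pcharf (pchar_Fp pp)) -(coef_map intr) q0 coef0.
  by move=> /dvdzP[y ->]; exists y; rewrite mulrC natz.
exists (\poly_(i < size q) g i); apply/polyP => i.
rewrite -polyC_natr coefCM coef_poly.
by case: ltnP => h; [rewrite gE | rewrite mulr0 nth_default].
Qed.

Lemma prime_elt_XsubC (c : int) : prime_elt ('X - c%:P).
Proof.
split; first by rewrite -size_poly_eq0 size_XsubC.
exists int, (horner_eval c) => q; rewrite /horner_eval; split=> [/eqP|[y ->]].
  by move=> /factor_theorem[y ->]; exists y; rewrite mulrC.
by rewrite /= /horner_eval hornerM hornerXsubC subrr mul0r.
Qed.

Lemma pfactored_nat (n : nat) : (0 < n)%N -> pfactored (n%:R : {poly int}).
Proof.
have [m] := ubnP n; elim: m n => // m IH n; rewrite ltnS => nm n0.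
have [->|n1] := eqVneq n 1%N; first by apply: pfactored_unit; rewrite unitr1.
have n1' : (1 < n)%N by rewrite ltn_neqAle eq_sym n1.
rewrite -(divnK (pdiv_dvd n)) natrM mulrC; apply: pfactored_mul.
  by apply: prime_elt_intC; rewrite pdiv_prime.
apply: IH; last by rewrite divn_gt0 ?pdiv_gt0 // dvdn_leq ?pdiv_dvd.
by rewrite (leq_trans _ nm) // ltn_Pdiv // prime_gt1 // pdiv_prime.
Qed.

Lemma pfactored_intC (z : int) : z != 0 -> pfactored (z%:P : {poly int}).
Proof.
move=> z0; have -> : z%:P = (Num.sg z)%:P * `|z|%N%:R :> {poly int}.
  by rewrite -polyC_natr -polyCM natz abszE -numEsg.
apply: pfactoredM; last by apply: pfactored_nat; rewrite absz_gt0.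
by apply: pfactored_unit; rewrite poly_unitE size_polyC sgr_eq0 z0 coefC /=; case: sgrP z0.
Qed.


(** For equal signs [b] cancels and [c] is a dummy. For opposite signs the integer part is even, so
    2 or -2 can be pulled out, leaving a monic linear factor. *)
Lemma eig_sub_factor (l l' : lab) : l != l' -> exists z c : int, z != 0 /\
  eig bX l' - eig bX l = z%:P * (if l.1 == l'.1 then 1 else 'X - c%:P).
Proof.
case: l l' => [[] k] [[] k'] nl; rewrite /eig /=.
- exists (2 * (k'%:R - k%:R)), 0; split; last by ring.
  by rewrite mulf_neq0 // subr_eq0 eqr_nat; apply: contraNneq nl => ->.
- by exists (- 2), (k'%:R - k%:R); split; last by ring.
- by exists 2, (k%:R - k'%:R); split; last by ring.
- exists (2 * (k'%:R - k%:R)), 0; split; last by ring.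
  by rewrite mulf_neq0 // subr_eq0 eqr_nat; apply: contraNneq nl => ->.
Qed.

Lemma pfactored_eig (l l' : lab) : l != l' -> pfactored (eig bX l' - eig bX l).
Proof.
have pf1 : pfactored (1 : {poly int}) by apply: pfactored_unit; rewrite unitr1.
move=> /eig_sub_factor[z [c [z0 ->]]]; apply: pfactoredM; first exact: pfactored_intC.
case: ifP => // _; rewrite -[_ - _]mulr1; apply: pfactored_mul => //.
exact: prime_elt_XsubC.
Qed.

Lemma pfactored_kap s : uniq s -> pfactored (kap bX s).
Proof.
move=> us; apply: pfactored_prod => i _; apply: pfactored_prod => j ij.
by apply: pfactored_eig; rewrite nth_uniq // neq_ltn ij.
Qed.

Lemma pfactored_neq0 (A : idomainType) (c : A) : pfactored c -> c != 0.
Proof.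
by elim=> [u|p d [p0 _] _ d0]; [apply: contraTneq => ->; rewrite unitr0 | rewrite mulf_neq0].
Qed.

Lemma kap_neq0 s : uniq s -> kap bX s != 0.
Proof. by move=> us; apply/pfactored_neq0/pfactored_kap. Qed.

Lemma tau_neq0 s : uniq s -> tau bX s != 0.
Proof. by move=> /kap_neq0; apply: contraNneq => t0; rewrite -tau_coef0 t0 coef0. Qed.

(* The polynomial of the theorem is [Phi] with its coefficients reversed. *)
Definition is_quot (s : seq lab) (Phi : {poly {poly int}}) : Prop :=
  tau bX s = (kap bX s)%:P * Phi.

(** A permutation multiplies [tau] and its constant term [kap] by the same sign. *)
Lemma is_quot_perm s s' Phi : perm_eq s s' -> is_quot s Phi -> is_quot s' Phi.
Proof.
move=> /(@tau_perm _ bX)[e E] q; rewrite /is_quot E q mulrA; congr (_ * _).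
rewrite -[kap _ s']tau_coef0 E -tau_coef0.
by rewrite -!(rmorph_sign (@polyC {poly int})) coefCM polyCM.
Qed.

Lemma uniq_rcons2 (T : seq lab) g h : uniq (rcons (rcons T g) h) ->
  [/\ uniq T, uniq (rcons T g), uniq (rcons T h) & h != g].
Proof.
rewrite !rcons_uniq mem_rcons inE negb_or => /andP[/andP[hg hT] /andP[gT uT]].
by split=> //; apply/andP; split.
Qed.

Lemma quot_darboux T g h P Pg Ph Pgh : uniq (rcons (rcons T g) h) ->
    is_quot T P -> is_quot (rcons T g) Pg -> is_quot (rcons T h) Ph ->
    is_quot (rcons (rcons T g) h) Pgh ->
  2 * (Pg * Ph) = (2 + (2 * (size T)%:R) *: 'X) * (P * Pgh)
    - 'X * ((eig bX g + eig bX h)%:P * (P * Pgh)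
            - 2 * 'X * (P * deriv Pgh - deriv P * Pgh)).
Proof.
move=> u q qg qh qgh; have [uT ug uh hg] := uniq_rcons2 u.
have k0 : ((kap bX T)%:P * (kap bX (rcons (rcons T g) h))%:P : {poly {poly int}}) != 0.
  by rewrite mulf_neq0 // polyC_eq0 kap_neq0.
have := tau_darboux g h (tau_neq0 uT); rewrite q qg qh qgh !derivM !derivC !mul0r !add0r => E.
apply: (mulfI k0); rewrite -[in LHS]polyCM kap_darboux !polyCM.
transitivity ((2 * (eig bX h - eig bX g))%:P * ((kap bX (rcons T g))%:P * Pg
   * ((kap bX (rcons T h))%:P * Ph))); first by rewrite polyCM; ring.
by rewrite E; ring.
Qed.

(** If every member of each family were below the size of that family, both families would be full
    staircases and the total would not exceed [low s]. *)
Lemma ex_big s : uniq s -> (low s < tot s)%N ->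
  exists sg g, (sg, g) \in s /\ (size (fam sg s) <= g)%N.
Proof.
move=> us lt; apply: contrapT => h; move: lt; apply/negP; rewrite -leqNgt tot_fam.
have small sg k : k \in fam sg s -> (k < size (fam sg s))%N.
  by rewrite mem_fam ltnNge => ks; apply/negP => hk; apply: h; exists sg, k.
by apply: leq_add; rewrite sum_staircase ?fam_uniq // => k; apply: small.
Qed.

Lemma ex_quot s : uniq s -> exists Phi, is_quot s Phi.
Proof.
have [n] := ubnP (tot s - low s); elim: n s => // n IH s dn us.
have [d0|d0] := leqP (tot s) (low s).
  exists 1; rewrite /is_quot mulr1 -tau_coef0; apply: size1_polyC.
  by rewrite (leq_trans (size_tau _ us)) // ltnS leqn0 subn_eq0.
(* With [k] the size of the family [sg], dropping [g] lowers [tot - low] by [g - (k - 1)] and adding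
   [h] lowers it by [k - h]. Both amounts are positive, so induction reaches [T] and the list with
   both labels. *)
have [sg [g [gs hg]]] := ex_big us d0.
have [|h hr hs] := ex_gap (fam_uniq sg us) _ hg; first by rewrite mem_fam.
rewrite mem_fam in hs.
set G := (sg, g); set H := (sg, h); set T := rem G s.
have pT : perm_eq s (rcons T G) by rewrite perm_sym perm_rcons perm_sym perm_to_rem.
have uTG : uniq (rcons T G) by rewrite -(perm_uniq pT).
have u2 : uniq (rcons (rcons T G) H).
  by rewrite rcons_uniq uTG andbT -(perm_mem pT).
have [uT _ uTH HG] := uniq_rcons2 u2.
have szs : size (fam sg s) = (size (fam sg T)).+1.
  by rewrite !size_fam (perm_big _ pT) -cats1 big_cat big_seq1 /= eqxx addn1.
have := perm_tot pT; rewrite tot_rcons /= => totE.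
have := perm_low pT; rewrite low_rcons /= => lowE.
have lT := low_le_tot uT; have l2 := low_le_tot u2.
have tot2 : tot (rcons (rcons T G) H) = (tot s + h)%N.
  by rewrite tot_rcons -(perm_tot pT).
have low2 : low (rcons (rcons T G) H) = (low s + size (fam sg s))%N.
  by rewrite low_rcons -(perm_low pT) !size_fam -(perm_big _ pT).
have [P qP] : exists P, is_quot T P by apply: IH => //; move: dn; lia.
have [P2 qP2] : exists P, is_quot (rcons (rcons T G) H) P.
  by apply: IH => //; move: dn; lia.
(* Nothing is known yet about [rcons T h]. Gauss' lemma is applied to the product of the two
   determinants, and only the quotients [P] and [P2] enter. *)
suff [U E] : exists U, tau bX (rcons T G) = ((tau bX (rcons T G))`_0)%:P * U.
  exists U; apply: (@is_quot_perm (rcons T G)); first by rewrite perm_sym.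
  by rewrite /is_quot {1}E tau_coef0.
(* Half of [eig bX G + eig bX H], still in [Z[b]]. This lets the overall factor 2 cancel, so that
   [W] is integral. *)
pose eps : {poly int} := g%:R + h%:R + sgb bX sg.
pose W := (1 + (size T)%:R *: 'X) * (P * P2)
  - 'X * (eps%:P * (P * P2) - 'X * (P * deriv P2 - deriv P * P2)).
apply: (@gauss_factor _ (kap bX (rcons T G) * kap bX (rcons T H)) _
          (tau bX (rcons T H)) W).
- by apply: pfactoredM; apply: pfactored_kap.
- by rewrite !tau_coef0.
have e0 : (2 * (eig bX H - eig bX G))%:P != 0 :> {poly {poly int}}.
  rewrite polyC_eq0 mulf_neq0 ?pfactored_neq0 //; first exact: (@pfactored_nat 2).
  by apply: pfactored_eig; rewrite eq_sym.
apply: (mulfI e0); rewrite tau_darboux ?tau_neq0 // qP qP2 !derivM !derivC !mul0r !add0r.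
have kE := kap_darboux bX T G H.
transitivity (2 * (kap bX T * kap bX (rcons (rcons T G) H))%:P * W).
  have -> : eig bX G + eig bX H = 2 * eps by rewrite /eig /eps /=; ring.
  by rewrite /W -!mul_polyC !polyCM; ring.
by rewrite kE !polyCM; ring.
Qed.

(** * Degrees and leading coefficients *)

Lemma quot_coef0 s Phi : uniq s -> is_quot s Phi -> Phi`_0 = 1.
Proof.
move=> us q; apply: (mulfI (kap_neq0 us)).
by rewrite mulr1 -[RHS]tau_coef0 q coefCM.
Qed.

Lemma size_quot s Phi : uniq s -> is_quot s Phi -> (size Phi <= (tot s - low s).+1)%N.
Proof.
move=> us q; rewrite -(size_Cmul Phi (kap_neq0 us)) -[(kap _ s)%:P * _]q.
exact: size_tau.
Qed.

Section Degrees.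
Variable A : idomainType.
Implicit Types p q : {poly A}.

Lemma size_mul_leqS p q a c : (size p <= a.+1)%N ->
  (size q <= c.+1)%N -> (size (p * q)%R <= (a + c).+1)%N.
Proof.
move=> pa qc; apply: (leq_trans (size_polyMleq _ _)).
lia.
Qed.

Lemma size_prod_leqS (I : Type) (r : seq I) (P : pred I) (G : I -> {poly A}) (e : I -> nat) :
  (forall i, P i -> (size (G i) <= (e i).+1)%N) ->
  (size (\prod_(i <- r | P i) G i)%R <= (\sum_(i <- r | P i) e i).+1)%N.
Proof.
move=> h; elim/big_rec2: _ => [|i c p Pi IH]; first by rewrite size_poly1.
by rewrite size_mul_leqS // h.
Qed.

Lemma size_prod_eqS (I : Type) (r : seq I) (P : pred I) (G : I -> {poly A}) (e : I -> nat) :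
  (forall i, P i -> size (G i) = (e i).+1) ->
  size (\prod_(i <- r | P i) G i) = (\sum_(i <- r | P i) e i)%N.+1.
Proof.
move=> h; elim/big_rec2: _ => [|i c p Pi IH]; first by rewrite size_poly1.
by rewrite size_mul -?size_poly_eq0 ?IH ?h // addnS.
Qed.
End Degrees.

Lemma size_int_nat (k : nat) : (size (k%:R : {poly int}) <= 1)%N.
Proof. by rewrite -polyC_natr size_polyC_leq1. Qed.

Lemma size_sgb sg : (size (sgb bX sg) <= 2)%N.
Proof. by case: sg; rewrite /sgb ?size_polyN size_polyX. Qed.

Lemma size_lagc l j : (size (lagc bX l j) <= j.+1)%N.
Proof.
rewrite /lagc; apply: (@size_mul_leqS _ _ _ 0%N j).
  apply: (@size_mul_leqS _ _ _ 0%N 0%N); last exact: size_int_nat.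
  by rewrite -(rmorph_sign (@polyC int)) size_polyC_leq1.
rewrite /poch -[j in (_ <= j.+1)%N]card_ord -sum1_card; apply: size_prod_leqS => i _.
apply: (leq_trans (size_polyD _ _)); rewrite geq_max (leq_trans (size_int_nat _)) // andbT.
apply: (leq_trans (size_polyD _ _)); rewrite geq_max (leq_trans (size_int_nat _)) // andbT.
exact: size_sgb.
Qed.

Lemma size_eig_sub (l l' : lab) (k k' : nat) :
  (size ((eig bX l' - 2 * k'%:R) - (eig bX l - 2 * k%:R))%R <= (l.1 != l'.1).+1)%N.
Proof.
have -> : (eig bX l' - 2 * k'%:R) - (eig bX l - 2 * k%:R) =
  (sgb bX l'.1 - sgb bX l.1) + (2 * l'.2%:R - 2 * k'%:R - 2 * l.2%:R + 2 * k%:R)%:P.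
  by rewrite !(polyCD, polyCN, polyCM) -!polyC_natr /eig; ring.
apply: (leq_trans (size_polyD _ _)); rewrite geq_max (leq_trans (size_polyC_leq1 _)) // andbT.
case: l.1 l'.1 => -[]; rewrite /sgb /= ?subrr ?size_poly0 //;
  by rewrite (leq_trans (size_polyD _ _)) // ?opprK ?size_polyN size_polyX.
Qed.

Lemma size_eig_sub_eq (l l' : lab) : l != l' ->
  size (eig bX l' - eig bX l) = (l.1 != l'.1).+1.
Proof.
move=> /eig_sub_factor[z [c [z0 ->]]]; rewrite size_Cmul //.
by case: eqP => _; rewrite ?size_poly1 ?size_XsubC.
Qed.

(** A term of [tau_sum] at [z ^ j] has degree in [b] at most [j] from its coefficients, plus one for
    each pair of labels of opposite sign. The degree of [kap] is exactly the number of such pairs,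
    so the quotient keeps at most [j]. *)
Lemma size_quot_coef s Phi j : uniq s -> is_quot s Phi -> (size (Phi`_j)%R <= j.+1)%N.
Proof.
move=> us q.
pose mixed := (\sum_(i < size s) \sum_(j < size s | (i < j)%N)
   ((nth l0 s i).1 != (nth l0 s j).1))%N.
have szk : size (kap bX s) = mixed.+1.
  apply: size_prod_eqS => i _; apply: size_prod_eqS => i' ii'.
  by apply: size_eig_sub_eq; rewrite nth_uniq // neq_ltn ii'.
have szt : (size ((tau bX s)`_j)%R <= (j + mixed).+1)%N.
  have sK l : l \in s -> (l.2 < (tot s).+1)%N.
    by move=> ls; rewrite ltnS /tot (perm_big _ (perm_to_rem ls)) big_cons leq_addr.
  rewrite (tau_sum _ sK) coef_sum.
  apply: (big_ind (fun p : {poly int} => (size p <= (j + mixed).+1)%N)).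
  - by rewrite size_poly0.
  - by move=> p p' hp hp'; rewrite (leq_trans (size_polyD _ _)) // geq_max hp.
  move=> f _; rewrite coefCM coefXn; case: eqP => [->|_]; last by rewrite mulr0 size_poly0.
  rewrite mulr1; apply: size_mul_leqS; first by apply: size_prod_leqS => c _; apply: size_lagc.
  apply: size_prod_leqS => i _; apply: size_prod_leqS => i' ii'.
  exact: size_eig_sub.
have [->|P0] := eqVneq (Phi`_j) 0; first by rewrite size_poly0.
move: szt; rewrite q coefCM size_mul ?kap_neq0 // szk addSn /= => szt.
by rewrite -(leq_add2l mixed) addnS addnC [(mixed + j)%N]addnC addnC.
Qed.

(** * The coefficients of [z] and [z ^ 2] *)

Section TopCoefficients.
Implicit Types s : seq lab.

Definition psum s k : {poly int} := \sum_(l <- s) eig bX l ^+ k.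

Definition top1 s : {poly int} := let N := (size s)%:R in
  - 3 * psum s 2 + 6 * (N - 1) * psum s 1 - 2 * N * (N - 1) * (N - 2) + 3 * N * bX ^+ 2.

(** Eight times the coefficient of [z ^ 2] in the logarithm of the quotient, just as [top1] is
    twelve times that of [z]. In power sums of eigenvalues the two families need no separate
    treatment. *)
Definition top2 s : {poly int} := let N := (size s)%:R in
  psum s 1 ^+ 2 - psum s 3 + 3 * (N - 1) * psum s 2 - 4 * (N - 1) ^+ 2 * psum s 1
  + N * (N - 1) ^+ 2 * (N - 2) + bX ^+ 2 * (psum s 1 - 2 * N ^+ 2 + N).

Lemma psum_rcons s l k : psum (rcons s l) k = psum s k + eig bX l ^+ k.
Proof. by rewrite /psum -cats1 big_cat big_seq1. Qed.

Lemma coefM1 (A : comNzRingType) (p q : {poly A}) : (p * q)`_1 = p`_0 * q`_1 + p`_1 * q`_0.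
Proof. by rewrite coefM !big_ord_recr big_ord0 /= add0r. Qed.

Lemma coefM2 (A : comNzRingType) (p q : {poly A}) :
  (p * q)`_2 = p`_0 * q`_2 + p`_1 * q`_1 + p`_2 * q`_0.
Proof. by rewrite coefM !big_ord_recr big_ord0 /= add0r. Qed.

Lemma darboux_coefs (A : comNzRingType) (P Q G H : {poly A}) (c e : A) :
    P`_0 = 1 -> Q`_0 = 1 -> G`_0 = 1 -> H`_0 = 1 ->
    2 * (G * H) = (2 + (2 * c) *: 'X) * (P * Q)
      - 'X * (e%:P * (P * Q) - 2 * 'X * (P * deriv Q - deriv P * Q)) ->
  2 * (G`_1 + H`_1) = 2 * (P`_1 + Q`_1) + (2 * c - e) /\
  2 * (G`_2 + G`_1 * H`_1 + H`_2) = 2 * (P`_2 + P`_1 * Q`_1 + Q`_2)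
    + (2 * c - e) * (P`_1 + Q`_1) + 2 * (Q`_1 - P`_1).
Proof.
move=> P0 Q0 G0 H0.
have -> : (2 + (2 * c) *: 'X) * (P * Q)
      - 'X * (e%:P * (P * Q) - 2 * 'X * (P * deriv Q - deriv P * Q)) =
  2 * (P * Q) + 'X * ((2 * c - e)%:P * (P * Q)) + 'X * ('X * (2 * (P * deriv Q - deriv P * Q))).
  by rewrite polyCB -mul_polyC; ring.
rewrite [2 * (G * H)]mulr_natl [2 * (P * Q)]mulr_natl [2 * (P * deriv Q - _)]mulr_natl => E.
have := congr1 (fun p : {poly A} => p`_1) E.
have := congr1 (fun p : {poly A} => p`_2) E.
rewrite !(coefMn, coefD, coefXM) /=.
rewrite !(coefMn, coefCM, coefB, coefN, coefM1, coefM2, coef0M, coef_deriv).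
rewrite P0 Q0 G0 H0 !mulr1 !mul1r ?addr0 => E2 E1; split.
  by rewrite [LHS]mulr_natl addrC E1; ring.
rewrite [LHS]mulr_natl (_ : G`_2 + _ + _ = H`_2 + G`_1 * H`_1 + G`_2); last by ring.
by rewrite E2; ring.
Qed.

(** Induction supplies the values for [T], [T] with [g], and [T] with [h]. All constant terms being
    1, the identity is then linear in the unknown coefficient of the full list. The lists of size 0
    and 1 are the base cases. *)
Lemma quot_top s Phi : uniq s -> is_quot s Phi ->
  12 * Phi`_1 = top1 s /\ 8 * Phi`_2 = 4 * Phi`_1 ^+ 2 + top2 s.
Proof.
have two0 : (2 : {poly int}) != 0 by apply/pfactored_neq0/(@pfactored_nat 2).
have [n] := ubnP (size s); elim: n s Phi => // n IH s Phi.
case/lastP: s => [_ _|s h].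
  rewrite /is_quot /kap /Delta big_ord0 mul1r /tau det_mx00 => <-.
  by rewrite !coef1 /top1 /top2 /psum !big_nil /=; split; ring.
case/lastP: s => [_ _|T g].
  rewrite /is_quot /kap /Delta big_ord1 big1 => [|[[]]] //.
  rewrite mul1r /tau det_mx11 mxE /= => <-.
  rewrite !coef_vrow !expr0 !mul1r /top1 /top2 /psum !big_seq1 /=.
  have c1 : lagc bX h 1 = - (h.2%:R * (sgb bX h.1 + h.2%:R)).
    by have := lagcS bX h 0; rewrite lagc0 mul1r mulr1 subn0.
  have c2 : 2 * lagc bX h 2 = h.2%:R * (h.2%:R - 1) *
      (sgb bX h.1 + h.2%:R) * (sgb bX h.1 + h.2%:R - 1).
    have := lagcS bX h 1; rewrite c1 => ->.
    have [->|h0] := posnP h.2; first by ring.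
    by rewrite natrB //; ring.
  have sq : sgb bX h.1 ^+ 2 = bX ^+ 2 by case: h.1; rewrite /sgb ?sqrrN.
  split; first by rewrite c1 -sq /eig; ring.
  have -> : 8 * lagc bX h 2 = 4 * (2 * lagc bX h 2) by ring.
  by rewrite c2 c1 -sq /eig; ring.
rewrite !size_rcons !ltnS => szT u q.
have [uT ug uh hg] := uniq_rcons2 u.
have [P qP] := ex_quot uT; have [Pg qg] := ex_quot ug; have [Ph qh] := ex_quot uh.
have [|A1 A2] := IH T P _ uT qP; first exact: ltnW.
have [|B1 B2] := IH (rcons T g) Pg _ ug qg; first by rewrite size_rcons.
have [|C1 C2] := IH (rcons T h) Ph _ uh qh; first by rewrite size_rcons.
have [E1 E2] := darboux_coefs (quot_coef0 uT qP) (quot_coef0 u q) (quot_coef0 ug qg)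
  (quot_coef0 uh qh) (quot_darboux u qP qg qh q).
have D1 : 12 * Phi`_1 = top1 (rcons (rcons T g) h).
  apply: (mulfI two0).
  transitivity (12 * (2 * (P`_1 + Phi`_1) + (2 * (size T)%:R - (eig bX g + eig bX h)))
     - 2 * (12 * P`_1) - 12 * (2 * (size T)%:R - (eig bX g + eig bX h))); first by ring.
  rewrite -E1; transitivity (2 * (12 * Pg`_1 + 12 * Ph`_1) - 2 * (12 * P`_1)
     - 12 * (2 * (size T)%:R - (eig bX g + eig bX h))); first by ring.
  rewrite A1 B1 C1 /top1 !size_rcons !psum_rcons -!natr1; ring.
split=> //.
(* Products of two first coefficients need [12 ^ 2 = 144] to be expressed through [top1]; the
   further 2 is that of the bilinear identity. *)
have n0 : (2 * 144 : {poly int}) != 0.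
  by rewrite -natrM; apply/pfactored_neq0/pfactored_nat.
apply: (mulfI n0).
set e := 2 * (size T)%:R - (eig bX g + eig bX h) in E1 E2 *.
transitivity (144 * 8 * (2 * (P`_2 + P`_1 * Phi`_1 + Phi`_2) + e * (P`_1 + Phi`_1)
    + 2 * (Phi`_1 - P`_1)) - 144 * 2 * (8 * P`_2) - 16 * (12 * P`_1) * (12 * Phi`_1)
    - 96 * e * (12 * P`_1 + 12 * Phi`_1) - 192 * (12 * Phi`_1 - 12 * P`_1)); first by ring.
rewrite -E2; transitivity (288 * (8 * Pg`_2) + 288 * (8 * Ph`_2) + 16 * (12 * Pg`_1) * (12 * Ph`_1)
    - 288 * (8 * P`_2) - 16 * (12 * P`_1) * (12 * Phi`_1)
    - 96 * e * (12 * P`_1 + 12 * Phi`_1) - 192 * (12 * Phi`_1 - 12 * P`_1)); first by ring.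
rewrite A2 B2 C2; transitivity (8 * (12 * Pg`_1) ^+ 2 + 288 * top2 (rcons T g)
    + 8 * (12 * Ph`_1) ^+ 2 + 288 * top2 (rcons T h) + 16 * (12 * Pg`_1) * (12 * Ph`_1)
    - 8 * (12 * P`_1) ^+ 2 - 288 * top2 T - 16 * (12 * P`_1) * (12 * Phi`_1)
    - 96 * e * (12 * P`_1 + 12 * Phi`_1) - 192 * (12 * Phi`_1 - 12 * P`_1)); first by ring.
transitivity (8 * (12 * Phi`_1) ^+ 2 + 288 * top2 (rcons (rcons T g) h)); last by ring.
rewrite D1 A1 B1 C1 /e /top1 /top2 !size_rcons !psum_rcons -!natr1.
by move: (psum T 1) (psum T 2) (psum T 3) (eig bX g) (eig bX h) (size T)%:R => *; ring.
Qed.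


End TopCoefficients.

(** * The constant coefficient *)

Arguments sgb : simpl never.

Section LastCoefficient.
Variable A : comNzRingType.
Implicit Types P Q G H : {poly A}.

Lemma coefM_last P Q a c : (size P <= a.+1)%N -> (size Q <= c.+1)%N ->
  (P * Q)`_(a + c) = P`_a * Q`_c.
Proof.
move=> szP szQ; rewrite coefM.
have aP : (a < (a + c).+1)%N by rewrite ltnS leq_addr.
rewrite (bigD1 (Ordinal aP)) //= addKn big1 ?addr0 // => -[i /= ip] ia.
have {}ia : i != a by [].
case: (ltngtP i a) ia => // ia _.
  by rewrite [Q`__]nth_default ?mulr0 // (leq_trans szQ) //; lia.
by rewrite [P`__]nth_default ?mul0r // (leq_trans szP).
Qed.

Lemma size_Xderiv P a : (size P <= a.+1)%N -> (size ('X * deriv P)%R <= a.+1)%N.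
Proof.
move=> szP; apply/leq_sizeP => j hj.
by rewrite coefX_deriv nth_default ?mulr0 // (leq_trans szP).
Qed.

(** At this power of [z] the bare product [P * Q] has run out of degree, while [z d/dz] multiplies a
    top coefficient by its degree; hence the term [2 * (a' - a)]. *)
Lemma darboux_last P Q G H (c e : A) a a' g h :
    (size P <= a.+1)%N -> (size Q <= a'.+1)%N -> (size G <= g.+1)%N -> (size H <= h.+1)%N ->
    (g + h = (a + a').+1)%N ->
    2 * (G * H) = (2 + (2 * c) *: 'X) * (P * Q)
      - 'X * (e%:P * (P * Q) - 2 * 'X * (P * deriv Q - deriv P * Q)) ->
  2 * (G`_g * H`_h) = (2 * c - e + 2 * (a'%:R - a%:R)) * (P`_a * Q`_a').
Proof.
move=> szP szQ szG szH gh.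
have -> : (2 + (2 * c) *: 'X) * (P * Q)
      - 'X * (e%:P * (P * Q) - 2 * 'X * (P * deriv Q - deriv P * Q)) =
  2 * (P * Q) + 'X * ((2 * c - e)%:P * (P * Q))
    + 'X * (2 * (P * ('X * deriv Q) - 'X * deriv P * Q)).
  by rewrite polyCB -mul_polyC; ring.
rewrite [2 * (G * H)]mulr_natl [2 * (P * Q)]mulr_natl [2 * (P * _ - _)]mulr_natl.
move=> /(congr1 (fun p : {poly A} => p`_(g + h))).
rewrite coefMn (coefM_last szG szH) gh !(coefMn, coefD, coefXM) /= !(coefMn, coefCM, coefD, coefN).
rewrite !(coefM_last, size_Xderiv) // !coefX_deriv.
have -> : (P * Q)`_(a + a').+1 = 0.
  rewrite nth_default // (leq_trans (size_polyMleq _ _)) //; lia.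
by move=> E; rewrite mulr_natl E; ring.
Qed.

End LastCoefficient.

(** * The closed form of the last coefficient *)

Section PhiZero.
Variables (K : fieldType) (be : K).
Hypothesis be_nint : forall z : int, be != z%:~R.

Lemma int_sub_be_neq0 (z : int) : z%:~R - be != 0.
Proof. by rewrite subr_eq0 eq_sym be_nint. Qed.

Lemma nat_sub_be_neq0 (i j : nat) : j%:R - i%:R - be != 0.
Proof. by have := int_sub_be_neq0 (j%:Z - i%:Z); rewrite rmorphB. Qed.

Lemma sgb_nat_neq0 sg (j : nat) : sgb be sg + 1 + j%:R != 0.
Proof.
case: sg; rewrite /sgb.
  have := int_sub_be_neq0 (- (1 + j%:Z)); rewrite rmorphN rmorphD /= -oppr_eq0.
  by rewrite opprB opprK addrA.
by have := int_sub_be_neq0 (1 + j%:Z); rewrite rmorphD /= addrC addrA.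
Qed.

Lemma poch_sgb_neq0 sg m : poch (sgb be sg + 1) m != 0.
Proof. by apply/prodf_neq0 => i _; apply: sgb_nat_neq0. Qed.

Lemma prod_poch_neq0 sg n : \prod_(i < n) poch (sgb be sg + 1) i != 0.
Proof. by apply/prodf_neq0 => i _; apply: poch_sgb_neq0. Qed.

(** The part of the closed formula that depends on the family sizes only. The denominators are what
    remains when each Pochhammer factor [(b + i + 1)_(m_i - i)] is written as
    [(b + 1)_(m_i) / (b + 1)_i]. *)
Definition stairc (r s : nat) : K :=
  (\prod_(i < r) \prod_(j < s) (j%:R - i%:R - be)) /
  ((\prod_(i < r) poch (sgb be true + 1) i) * (\prod_(j < s) poch (sgb be false + 1) j)).

Lemma stairc_neq0 r s : stairc r s != 0.
Proof.
rewrite /stairc mulf_neq0 ?invr_neq0 ?mulf_neq0 //; apply/prodf_neq0 => i _;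
  rewrite ?poch_sgb_neq0 //.
by apply/prodf_neq0 => j _; apply: nat_sub_be_neq0.
Qed.

Lemma pochSr (F : comNzRingType) (z : F) m : poch z m.+1 = poch z m * (z + m%:R).
Proof. by rewrite /poch big_ord_recr. Qed.

Lemma ratio_step (P Q t z p : K) : z != 0 -> p != 0 -> P * t = z * Q ->
  Q / p = t * (P / (p * z)).
Proof.
move=> z0 p0 E; have -> : Q = P * t / z by rewrite E mulrAC mulfV // mul1r.
by field; rewrite z0 p0.
Qed.

(** Passing from [r] to [r.+1] multiplies by [q r]. In [q r / q r.+1] the two products over [j] are
    shifts of one another and telescope, and the Pochhammer ratio cancels one of the two end
    factors. *)
Lemma stairc_recl r s :
  stairc r.+1 s ^+ 2 = (be + r%:R + 1 - s%:R) * (stairc r s * stairc r.+2 s).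
Proof.
pose q i := (\prod_(j < s) (j%:R - i%:R - be)) / poch (sgb be true + 1) i.
have cS i : stairc i.+1 s = stairc i s * q i.
  rewrite /stairc /q !big_ord_recr /=; field.
  by rewrite poch_sgb_neq0 !prod_poch_neq0.
have qS : q r = (be + r%:R + 1 - s%:R) * q r.+1.
  have tel : (\prod_(j < s) (j%:R - r.+1%:R - be)) * (s%:R - r.+1%:R - be) =
      - (sgb be true + 1 + r%:R) * \prod_(j < s) (j%:R - r%:R - be).
    transitivity (\prod_(j < s.+1) (j%:R - r.+1%:R - be)); first by rewrite big_ord_recr.
    rewrite big_ord_recl /=; congr (_ * _); first by rewrite /sgb -natr1; ring.
    by apply: eq_bigr => j _; rewrite /bump /= -[r.+1%:R]natr1 natrD; ring.
  rewrite /q pochSr; have z0 := sgb_nat_neq0 true r; have p0 := poch_sgb_neq0 true r.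
  have -> : be + r%:R + 1 - s%:R = - (s%:R - r.+1%:R - be) by rewrite -natr1; ring.
  by apply: ratio_step => //; rewrite mulrN tel mulNr opprK.
by rewrite !cS qS; ring.
Qed.

Lemma stairc_recr r s :
  stairc r s.+1 ^+ 2 = (- be + s%:R + 1 - r%:R) * (stairc r s * stairc r s.+2).
Proof.
pose q j := (\prod_(i < r) (j%:R - i%:R - be)) / poch (sgb be false + 1) j.
have cS j : stairc r j.+1 = stairc r j * q j.
  rewrite /stairc /q.
  have -> : \prod_(i < r) \prod_(j0 < j.+1) (j0%:R - i%:R - be) =
     (\prod_(i < r) \prod_(j0 < j) (j0%:R - i%:R - be)) * \prod_(i < r) (j%:R - i%:R - be).
    by rewrite -big_split; apply: eq_bigr => i _; rewrite big_ord_recr.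
  rewrite [in LHS]big_ord_recr /=; field.
  by rewrite poch_sgb_neq0 !prod_poch_neq0.
have qS : q s = (- be + s%:R + 1 - r%:R) * q s.+1.
  have tel : (\prod_(i < r) (s.+1%:R - i%:R - be)) * (s.+1%:R - r%:R - be) =
      (sgb be false + 1 + s%:R) * \prod_(i < r) (s%:R - i%:R - be).
    transitivity (\prod_(i < r.+1) (s.+1%:R - i%:R - be)); first by rewrite big_ord_recr.
    rewrite big_ord_recl /=; congr (_ * _); first by rewrite /sgb -natr1; ring.
    by apply: eq_bigr => j _; rewrite /bump /= -[s.+1%:R]natr1 natrD; ring.
  rewrite /q pochSr; have z0 := sgb_nat_neq0 false s; have p0 := poch_sgb_neq0 false s.
  have -> : - be + s%:R + 1 - r%:R = s.+1%:R - r%:R - be by rewrite -natr1; ring.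
  by apply: ratio_step.
by rewrite !cS qS; ring.
Qed.

Definition mix (s : seq lab) : K :=
  \prod_(k <- fam true s) \prod_(k' <- fam false s) (k'%:R - k%:R - be).

(** The claimed value of the last coefficient, regrouped by labels, family sizes and mixed pairs.
    The sum [tot s + low s] has the parity of the degree. *)
Definition phi0F (s : seq lab) : K :=
  (-1) ^+ (tot s + low s) * (\prod_(l <- s) poch (sgb be l.1 + 1) l.2) *
  stairc (size (fam true s)) (size (fam false s)) / mix s.

Lemma mix_neq0 s : mix s != 0.
Proof.
rewrite /mix; elim: (fam true s) => [|k ks IH]; first by rewrite big_nil oner_eq0.
rewrite big_cons mulf_neq0 //.
elim: (fam false s) => [|k' ks' IH']; first by rewrite big_nil oner_eq0.
by rewrite big_cons mulf_neq0 // nat_sub_be_neq0.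
Qed.

Lemma phi0F_neq0 s : phi0F s != 0.
Proof.
have p0 : \prod_(l <- s) poch (sgb be l.1 + 1) l.2 != 0.
  elim: s => [|l s IH]; first by rewrite big_nil oner_eq0.
  by rewrite big_cons mulf_neq0 // poch_sgb_neq0.
by rewrite /phi0F mulf_neq0 ?invr_eq0 ?mix_neq0 // mulf_neq0 ?stairc_neq0 // mulf_neq0 ?signr_eq0.
Qed.

Lemma perm_fam sg s s' : perm_eq s s' -> perm_eq (fam sg s) (fam sg s').
Proof. by move=> p; apply/perm_map/perm_filter. Qed.

Lemma perm_phi0F s s' : perm_eq s s' -> phi0F s = phi0F s'.
Proof.
move=> p; rewrite /phi0F (perm_tot p) (perm_low p) (perm_big _ p) /mix.
rewrite !(perm_size (perm_fam _ p)) (perm_big _ (perm_fam true p)).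
congr (_ * _^-1); apply: eq_bigr => k _; exact: (perm_big _ (perm_fam false p)).
Qed.

Lemma fam_rcons sg s l : fam sg (rcons s l) = if l.1 == sg then rcons (fam sg s) l.2 else fam sg s.
Proof. by rewrite /fam filter_rcons; case: ifP => // _; rewrite map_rcons. Qed.

Lemma big_rcons_mul (I : Type) (s : seq I) x (f : I -> K) :
  \prod_(i <- rcons s x) f i = (\prod_(i <- s) f i) * f x.
Proof. by rewrite -cats1 big_cat big_seq1. Qed.

(** The factor [c] depends only on the family of opposite sign, so it is the same whether or not
    another label of the sign of [l] is present. *)
Lemma mix_rcons s l : exists c, forall T, fam (~~ l.1) T = fam (~~ l.1) s ->
  mix (rcons T l) = mix T * c.
Proof.
case: l => -[] k /=.
  exists (\prod_(k' <- fam false s) (k'%:R - k%:R - be)) => T fT.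
  by rewrite /mix !fam_rcons /= big_rcons_mul fT.
exists (\prod_(k' <- fam true s) (k%:R - k'%:R - be)) => T fT.
rewrite /mix !fam_rcons /= fT -big_split /=; apply: eq_bigr => k' _.
by rewrite big_rcons_mul.
Qed.

Lemma darboux_alg (e1 e2 e3 e4 S pg ph c0 c1 c2 e m cg ch : K) :
    m != 0 -> cg != 0 -> ch != 0 -> e1 * e2 = - (e3 * e4) -> c1 ^+ 2 = e * (c0 * c2) ->
  (e1 * (S * pg) * c1 / (m * cg)) * (e2 * (S * ph) * c1 / (m * ch)) =
  - e * ((e3 * S * c0 / m) * (e4 * (S * pg * ph) * c2 / (m * cg * ch))).
Proof.
move=> m0 cg0 ch0 sE cE.
transitivity ((e1 * e2) * S ^+ 2 * pg * ph * c1 ^+ 2 / (m ^+ 2 * cg * ch)).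
  by field; rewrite m0 cg0 ch0.
by rewrite cE sE; field; rewrite m0 cg0 ch0.
Qed.

(** For [g] and [h] of one sign the label products and the mixed factors cancel. What remains is the
    recursion of [stairc] and a sign. *)
Lemma phi0F_darboux T sg kg kh (g := (sg, kg)) (h := (sg, kh)) :
  phi0F (rcons T g) * phi0F (rcons T h) =
  - (sgb be sg + (size (fam sg T))%:R + 1 - (size (fam (~~ sg) T))%:R) *
  (phi0F T * phi0F (rcons (rcons T g) h)).
Proof.
have [cg Eg] := mix_rcons T g; have [ch Eh] := mix_rcons T h.
have fTg : fam (~~ sg) (rcons T g) = fam (~~ sg) T.
  by rewrite fam_rcons /=; case: sg {g h cg Eg ch Eh}.
have cg0 : cg != 0 by have := mix_neq0 (rcons T g); rewrite Eg // mulf_eq0 negb_or => /andP[].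
have ch0 : ch != 0 by have := mix_neq0 (rcons T h); rewrite Eh // mulf_eq0 negb_or => /andP[].
have m0 := mix_neq0 T.
rewrite /phi0F (Eh (rcons T g)) // (Eg T) // (Eh T) // !tot_rcons !low_rcons !big_rcons_mul /=.
have szE : size (fam sg (rcons T g)) = (size (fam sg T)).+1.
  by rewrite fam_rcons /= eqxx size_rcons.
rewrite szE.
have cE : stairc (size (fam true (rcons T g))) (size (fam false (rcons T g))) ^+ 2 =
    (sgb be sg + (size (fam sg T))%:R + 1 - (size (fam (~~ sg) T))%:R) *
    (stairc (size (fam true T)) (size (fam false T)) *
     stairc (size (fam true (rcons (rcons T g) h))) (size (fam false (rcons (rcons T g) h)))).
  rewrite !fam_rcons /=; case: (sg); rewrite !size_rcons; [exact: stairc_recl | exact: stairc_recr].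
have cgh : stairc (size (fam true (rcons T h))) (size (fam false (rcons T h))) =
    stairc (size (fam true (rcons T g))) (size (fam false (rcons T g))).
  by rewrite !fam_rcons /=; case: (sg); rewrite !size_rcons.
rewrite cgh.
move: cE; set c0 := stairc (size (fam true T)) _; set c1 := stairc (size (fam true (rcons T g))) _.
set c2 := stairc _ _; set e := sgb be sg + _ + 1 - _; set S := \prod_(l <- T) _.
set pg := poch _ kg; set ph := poch _ kh => cE.
set e1 := (-1) ^+ _; set e2 := (-1) ^+ _; set e3 := (-1) ^+ _; set e4 := (-1) ^+ _.
have sE : e1 * e2 = - (e3 * e4).
  rewrite /e1 /e2 /e3 /e4 -!exprD -[RHS]mulN1r -exprS -[LHS]signr_odd -[RHS]signr_odd.
  congr (_ ^+ nat_of_bool _); rewrite /= !oddD /=.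
  move: (tot T) 'C(_, 2) 'C(_, 2) (size (fam sg T)) => t c c' z.
  by case: (odd t); case: (odd c); case: (odd c'); case: (odd z); case: (odd kg); case: (odd kh).
exact: darboux_alg.
Qed.

End PhiZero.

Lemma tofracX_nint (z : int) : bF != z%:~R :> {fraction {poly int}}.
Proof.
rewrite -(rmorph_int (@tofrac {poly int})) tofrac_eq.
apply/eqP => /(congr1 (fun p : {poly int} => size p)).
rewrite size_polyX -(rmorph_int (@polyC int)) => h.
by have := size_polyC_leq1 (z%:~R : int); rewrite -h.
Qed.

Lemma lagc_last l : tofrac (lagc bX l l.2) = (-1) ^+ l.2 * poch (sgb bF l.1 + 1) l.2.
Proof.
rewrite /lagc binn subnn mulr1 rmorphM rmorph_sign /= poch_map rmorphD rmorph1.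
by rewrite sgb_map.
Qed.

Lemma mixed_base_alg (K : fieldType) (x y s1 s2 p1 p2 : K) : y - x != 0 ->
  - 2 * x * (s1 * p1 * (s2 * p2)) =
  2 * (y - x) * (s1 * s2 * (p1 * p2) * ((0 - 0 - x) / 1) / (y - x)).
Proof. by move=> yx; field; rewrite yx oner_eq0. Qed.

(** The induction removes pairs of labels of one sign, so it stops when each family has at most one
    member. The mixed pair is a two-by-two determinant. *)
Lemma phi0_base m n Phi (s := [seq (true, k) | k <- m] ++ [seq (false, k) | k <- n]) :
    (size m <= 1)%N -> (size n <= 1)%N -> is_quot s Phi ->
  tofrac (Phi`_(tot s - low s)) = phi0F bF s.
Proof.
have b0 : 'C(0, 2) = 0%N by []; have b1 : 'C(1, 2) = 0%N by [].
rewrite /s {s}; case: m => [|k [|//]]; case: n => [|k' [|//]] _ _ /=.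
- rewrite /is_quot /kap /Delta big_ord0 mul1r /tau det_mx00 => <-.
  rewrite /phi0F /stairc /mix /tot /low /fam /= ?b0 ?b1 !big_nil !big_ord0 coef1 /= expr0 rmorph1.
  by rewrite !mulr1 invr1 !mulr1 ?addn0.
- rewrite /is_quot /kap /Delta big_ord1 big1 => [|[[]]] //.
  rewrite mul1r /tau det_mx11 mxE /= => <-.
  rewrite /phi0F /stairc /mix /tot /low /fam /= ?b0 ?b1 !big_seq1 !big_nil !big_ord0 !big_ord1 /=.
  rewrite subn0 addn0 coef_vrow expr0 mul1r (lagc_last (false, k')) /poch big_ord0.
  by rewrite !mulr1 invr1 !mulr1 addn0.
- rewrite /is_quot /kap /Delta big_ord1 big1 => [|[[]]] //.
  rewrite mul1r /tau det_mx11 mxE /= => <-.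
  rewrite /phi0F /stairc /mix /tot /low /fam /= ?b0 ?b1 !big_seq1 !big_nil !big_ord0 !big_ord1 /=.
  rewrite subn0 addn0 coef_vrow expr0 mul1r (lagc_last (true, k)) /poch !big_ord0.
  by rewrite !mulr1 invr1 !mulr1 ?addn0.
rewrite /is_quot.
have -> : kap bX [:: (true, k); (false, k')] = 2 * (k'%:R - k%:R - bX).
  rewrite -[[:: _; _]]/(rcons [:: (true, k)] (false, k')) kap_rcons big_seq1.
  rewrite /kap /Delta big_ord1 big1 => [|[[]]] //.
  by rewrite /eig /sgb /=; ring.
have -> : tau bX [:: (true, k); (false, k')] =
    vrow bX 0 (true, k) * vrow bX 1 (false, k') - vrow bX 0 (false, k') * vrow bX 1 (true, k).
  rewrite /tau /= (expand_det_row _ ord0) !big_ord_recl big_ord0 addr0 /cofactor !det_mx11 !mxE /=.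
  by rewrite expr0 expr1 mul1r mulN1r mulrN.
move=> /(congr1 (fun p : {poly {poly int}} => tofrac (p`_(k + k')))).
have szv a l : (size (vrow bX a l) <= l.2.+1)%N by apply: size_poly.
rewrite coefB (@coefM_last _ _ _ k k') ?szv // [(k + k')%N]addnC (@coefM_last _ _ _ k' k) ?szv //.
rewrite !coef_vrow coefCM !expr0 !expr1 !mul1r => E.
rewrite /phi0F /stairc /mix /tot /low /fam /= ?b0 ?b1 !big_cons !big_nil !big_ord1 /= !addn0 subn0.
apply: (@mulfI _ (2 * (k'%:R - k%:R - bF))).
  rewrite mulf_neq0 ?(nat_sub_be_neq0 tofracX_nint) //.
  rewrite -(rmorph_nat (@tofrac {poly int}) 2) tofrac_eq0.
  exact/pfactored_neq0/(@pfactored_nat 2).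
have tE : tofrac (2 * (k'%:R - k%:R - bX)) = 2 * (k'%:R - k%:R - bF).
  by rewrite rmorphM !rmorphB !rmorph_nat.
rewrite [(k' + k)%N]addnC in E.
transitivity (tofrac (2 * (k'%:R - k%:R - bX) * Phi`_(k + k'))).
  by rewrite rmorphM /= tE ?b1 ?addn0 ?subn0.
rewrite -E.
have n0 := nat_sub_be_neq0 tofracX_nint k k'.
have LT := lagc_last (true, k); have LF := lagc_last (false, k'); rewrite /= in LT LF.
rewrite /eig /sgb /=.
move: LT LF; move: (lagc _ _ k) (lagc _ _ k') => c1 c2 LT LF.
(* At the top coefficients the shifted eigenvalues are [b] and [-b], whence the factor [-2 b]. *)
rewrite (_ : c1 * _ - c2 * _ = - 2 * bX * (c1 * c2)); last by ring.
rewrite !rmorphM /= LT LF rmorphN rmorph_nat /poch !big_ord0 ?b1 ?addn0 !mulr1 exprD /sgb.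
move: (\prod_(j < k) _) (\prod_(j < k') _) ((-1) ^+ k) ((-1) ^+ k') => p1 p2 s1 s2.
exact: mixed_base_alg.
Qed.

Lemma fam_split_perm s :
  perm_eq s ([seq (true, k) | k <- fam true s] ++ [seq (false, k) | k <- fam false s]).
Proof.
have mapK sg : [seq (sg, k) | k <- fam sg s] = [seq l <- s | l.1 == sg].
  rewrite /fam -map_comp -[RHS]map_id; apply/eq_in_map => -[x1 x2].
  by rewrite mem_filter /= => /andP[/eqP ->].
rewrite !mapK perm_sym.
rewrite -(@eq_filter _ (predC (fun l : lab => l.1 == true)) (fun l => l.1 == false));
  last by case=> -[].
by rewrite perm_filterC.
Qed.

(** [darboux_last] and [phi0F_darboux] are the same recursion. It determines the unknown value
    because [e] and [phi0F] of [T] are nonzero in the fraction field. *)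
Lemma phi0_quot s Phi : uniq s -> is_quot s Phi ->
  tofrac (Phi`_(tot s - low s)) = phi0F bF s.
Proof.
have [n] := ubnP (size s); elim: n s Phi => // n IH s Phi szs us q.
have permE (s' : seq lab) : perm_eq s s' -> tofrac (Phi`_(tot s' - low s')) = phi0F bF s' ->
    tofrac (Phi`_(tot s - low s)) = phi0F bF s.
  by move=> p E; rewrite (perm_tot p) (perm_low p) E (perm_phi0F _ p).
have [st|/existsNP[sg /negP]] := pselect (forall sg, (size (fam sg s) <= 1)%N).
  have p := fam_split_perm s; apply: (permE _ p); apply: phi0_base => //.
  exact: is_quot_perm p q.
rewrite -ltnNge; case fE : (fam sg s) => [|kg [|kh ks]] // _.
set g := (sg, kg); set h := (sg, kh); set T := rem h (rem g s).
have uf : kg != kh by have := fam_uniq sg us; rewrite fE /= inE negb_or => /andP[/andP[]].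
have gs : g \in s by rewrite -mem_fam fE mem_head.
have hs : h \in rem g s.
  rewrite mem_rem_uniq // inE -mem_fam fE !inE eqxx orbT andbT.
  by rewrite xpair_eqE eqxx eq_sym.
have p : perm_eq s (rcons (rcons T g) h).
  rewrite perm_sym perm_rcons perm_sym (permPl (perm_to_rem gs)).
  rewrite (permPl (_ : perm_eq _ (g :: h :: T))); last by rewrite perm_cons perm_to_rem.
  by rewrite -[g :: _]/([:: g] ++ [:: h] ++ T) perm_catCA perm_cons perm_sym perm_rcons.
have q2 := is_quot_perm p q; apply: (permE _ p).
have u2 : uniq (rcons (rcons T g) h) by rewrite -(perm_uniq p).
have [uT ug uh hg] := uniq_rcons2 u2.
have szT : (size T < n.-1)%N by move: szs; rewrite (perm_size p) !size_rcons; lia.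
have [P qP] := ex_quot uT; have [Pg qg] := ex_quot ug; have [Ph qh] := ex_quot uh.
have A1 := IH T P _ uT qP.
have A2 := IH (rcons T g) Pg _ ug qg; have A3 := IH (rcons T h) Ph _ uh qh.
rewrite !size_rcons in A2 A3.
have {}A1 : tofrac P`_(tot T - low T) = phi0F bF T by apply: A1; lia.
have {}A2 : tofrac Pg`_(tot (rcons T g) - low (rcons T g)) = phi0F bF (rcons T g) by apply: A2; lia.
have {}A3 : tofrac Ph`_(tot (rcons T h) - low (rcons T h)) = phi0F bF (rcons T h) by apply: A3; lia.
have lT := low_le_tot uT; have lg := low_le_tot ug; have lh := low_le_tot uh.
have lgh := low_le_tot u2.
have szg : size (fam sg (rcons T g)) = (size (fam sg T)).+1.
  by rewrite fam_rcons /= eqxx size_rcons.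
have totg : tot (rcons T g) = (tot T + kg)%N by rewrite tot_rcons.
have toth : tot (rcons T h) = (tot T + kh)%N by rewrite tot_rcons.
have totgh : tot (rcons (rcons T g) h) = (tot T + kg + kh)%N by rewrite !tot_rcons.
have lowg : low (rcons T g) = (low T + size (fam sg T))%N by rewrite low_rcons.
have lowh : low (rcons T h) = (low T + size (fam sg T))%N by rewrite low_rcons.
have lowgh : low (rcons (rcons T g) h) = (low T + size (fam sg T) + (size (fam sg T)).+1)%N.
  by rewrite low_rcons /= szg lowg.
have := darboux_last (size_quot uT qP) (size_quot u2 q2) (size_quot ug qg) (size_quot uh qh) _
  (quot_darboux u2 qP qg qh q2).
move=> E; have dE : (tot (rcons T g) - low (rcons T g) + (tot (rcons T h) - low (rcons T h)) =
    (tot T - low T + (tot (rcons (rcons T g) h) - low (rcons (rcons T g) h))).+1)%N.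
  rewrite totg toth totgh lowg lowh lowgh in lg lh lgh *.
  by move: (tot T) (low T) (size _) lT lg lh lgh => *; lia.
have {dE}E := E dE.
have szTf : size T = (size (fam sg T) + size (fam (~~ sg) T))%N.
  rewrite (perm_size (fam_split_perm T)) size_cat !size_map.
  by case: (sg) => //=; rewrite addnC.
set e := sgb bX sg + (size (fam sg T))%:R + 1 - (size (fam (~~ sg) T))%:R.
have {}E : Pg`_(tot (rcons T g) - low (rcons T g)) * Ph`_(tot (rcons T h) - low (rcons T h)) =
   - e * (P`_(tot T - low T) * Phi`_(tot (rcons (rcons T g) h) - low (rcons (rcons T g) h))).
  apply: (@mulfI _ 2); first exact/pfactored_neq0/(@pfactored_nat 2).
  (* The labels [kg] and [kh] enter through the eigenvalues and through the degrees, and cancel;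
     only family sizes and [b] survive in [e]. *)
  rewrite E !mulrA; congr (_ * _ * _); rewrite szTf !natrB // totgh lowgh /eig /e /=.
  by rewrite !natrD -natr1; ring.
have eE : tofrac e = sgb bF sg + (size (fam sg T))%:R + 1 - (size (fam (~~ sg) T))%:R.
  by rewrite /e rmorphB !rmorphD !rmorph_nat rmorph1 /= sgb_map.
have e0 : tofrac e != 0.
  rewrite eE; case: (sg); rewrite /sgb.
    have := int_sub_be_neq0 tofracX_nint (- ((size (fam true T))%:Z + 1 - (size (fam false T))%:Z)).
    rewrite -oppr_eq0 opprB rmorphN opprK rmorphB rmorphD /= => h'; rewrite -!addrA in h' *.
    exact: h'.
  have := int_sub_be_neq0 tofracX_nint ((size (fam false T))%:Z + 1 - (size (fam true T))%:Z).
  rewrite rmorphB rmorphD /= addrC !addrA => h'; exact: h'.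
have := congr1 (@tofrac {poly int}) E.
rewrite !rmorphM /= A1 A2 A3 (phi0F_darboux tofracX_nint) -eE rmorphN => {}E.
have n0 : - tofrac e != 0 by rewrite oppr_eq0.
by have /(mulfI n0)/(mulfI (phi0F_neq0 tofracX_nint T))-> := E.
Qed.

(** * Derivatives of the gauged functions *)


Section ComplexDerivative.
Variable R : realType.
Local Notation Re := complex.Re.
Local Notation Im := complex.Im.
Implicit Types (f g : R -> R[i]) (x : R) (w : R[i]).

Definition is_cderive f x (df : R[i]) : Prop :=
  is_derive x 1 (fun t : R => Re (f t) : R^o) (Re df) /\
  is_derive x 1 (fun t : R => Im (f t) : R^o) (Im df).

Lemma is_cderive_eq f x df df' : is_cderive f x df -> df = df' -> is_cderive f x df'.
Proof. by move=> ? <-. Qed.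

Lemma ReM (a b : R[i]) : Re (a * b) = Re a * Re b - Im a * Im b.
Proof. by case: a b => a1 a2 [b1 b2]. Qed.

Lemma ImM (a b : R[i]) : Im (a * b) = Re a * Im b + Im a * Re b.
Proof. by case: a b => a1 a2 [b1 b2]. Qed.

Lemma ReD (a b : R[i]) : Re (a + b) = Re a + Re b.
Proof. by case: a b => a1 a2 [b1 b2]. Qed.

Lemma ImD (a b : R[i]) : Im (a + b) = Im a + Im b.
Proof. by case: a b => a1 a2 [b1 b2]. Qed.

Lemma is_cderiveM f g x df dg : is_cderive f x df -> is_cderive g x dg ->
  is_cderive (fun t => f t * g t) x (df * g x + f x * dg).
Proof.
move=> [f1 f2] [g1 g2]; split.
  have -> : (fun t : R => Re (f t * g t) : R^o) =
     (fun t => Re (f t) : R^o) * (fun t => Re (g t) : R^o)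
     - (fun t => Im (f t) : R^o) * (fun t => Im (g t) : R^o).
    by apply/funext => t; rewrite ReM.
  apply: is_derive_eq; rewrite ReD !ReM /GRing.scale /=; ring.
have -> : (fun t : R => Im (f t * g t) : R^o) =
   (fun t => Re (f t) : R^o) * (fun t => Im (g t) : R^o)
   + (fun t => Im (f t) : R^o) * (fun t => Re (g t) : R^o).
  by apply/funext => t; rewrite ImM.
apply: is_derive_eq; rewrite ImD !ImM /GRing.scale /=; ring.
Qed.

Lemma is_cderiveD f g x df dg : is_cderive f x df -> is_cderive g x dg ->
  is_cderive (fun t => f t + g t) x (df + dg).
Proof.
move=> [f1 f2] [g1 g2]; split; rewrite ?ReD ?ImD.
  have -> : (fun t : R => Re (f t + g t) : R^o) =
      (fun t => Re (f t) : R^o) + (fun t => Re (g t) : R^o).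
    by apply/funext => t; rewrite ReD.
  exact: is_deriveD.
have -> : (fun t : R => Im (f t + g t) : R^o) =
    (fun t => Im (f t) : R^o) + (fun t => Im (g t) : R^o).
  by apply/funext => t; rewrite ImD.
exact: is_deriveD.
Qed.

Lemma is_cderive_real (u : R -> R) x du : is_derive x (1 : R) (u : R -> R^o) du ->
  is_cderive (fun t => (u t)%:C) x du%:C.
Proof. by move=> h; split => //=; exact: is_derive_cst. Qed.

Lemma is_cderive_cst w x : is_cderive (fun=> w) x 0.
Proof. by split; exact: is_derive_cst. Qed.

Lemma is_cderive_horner (q : {poly R[i]}) x :
  is_cderive (fun t => q.[(t ^+ 2)%:C]) x (2 * x%:C * (deriv q).[(x ^+ 2)%:C]).
Proof.
elim/poly_ind: q => [|q c IH].
  rewrite derivC horner0 mulr0.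
  have -> : (fun t : R => (0 : {poly R[i]}).[(t ^+ 2)%:C]) = fun=> 0.
    by apply/funext => t; rewrite horner0.
  exact: is_cderive_cst.
have -> : (fun t : R => (q * 'X + c%:P).[(t ^+ 2)%:C]) =
    fun t => q.[(t ^+ 2)%:C] * (t ^+ 2)%:C + c by apply/funext => t; rewrite !hornerE.
have sq : is_derive x (1 : R) (fun t : R => t ^+ 2 : R^o) (2 * x).
  have -> : (fun t : R => t ^+ 2 : R^o) = (id : R -> R^o) * (id : R -> R^o) by [].
  by apply: is_derive_eq; rewrite /GRing.scale /= mulr1 mulr2n mulrDl mul1r.
apply: is_cderive_eq.
  apply: is_cderiveD; last exact: is_cderive_cst.
  by apply: is_cderiveM IH _; apply: is_cderive_real sq.
have tx : (2 * x)%:C = 2 * x%:C :> R[i] by rewrite -(rmorph_nat (real_complex R)) -rmorphM.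
by rewrite derivD derivC derivM derivX !hornerE /= tx; ring.
Qed.

Lemma cpowD x w w' : cpow x (w + w') = cpow x w * cpow x w'.
Proof.
rewrite /cpow; case: w w' => a b [a' b'] /=; rewrite !mulrDl expRD cosD sinD.
by apply/eqP; rewrite eq_complex /=; apply/andP; split; apply/eqP; ring.
Qed.

Lemma cpow_real x (a : R) : cpow x a%:C = (expR (a * ln x))%:C.
Proof. by rewrite /cpow /= mul0r cos0 sin0 mulr1 mulr0. Qed.

Lemma cpow_nat x (k : nat) : 0 < x -> cpow x k%:R = (x ^+ k)%:C.
Proof.
move=> x0; rewrite -(rmorph_nat (real_complex R)) cpow_real.
by rewrite expRM_natl lnK // posrE.
Qed.

Lemma cpow0 x : cpow x 0 = 1.
Proof. by have := cpow_real x 0; rewrite mul0r expR0. Qed.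

Lemma cpow_natN x (k : nat) : 0 < x -> cpow x (- k%:R) = ((x ^+ k)%:C)^-1.
Proof.
move=> x0; have k0 : (x ^+ k)%:C != 0 :> R[i].
  by rewrite -(rmorph0 (real_complex R)) (inj_eq (@complexI R)) expf_neq0 // gt_eqF.
by apply: (mulfI k0); rewrite mulfV // -cpow_nat // -cpowD subrr cpow0.
Qed.

Lemma is_cderive_cpow x w : 0 < x -> is_cderive (fun t => cpow t w) x (w * cpow x (w - 1)).
Proof.
move=> x0.
have x1 : cpow x (- 1) = (x^-1)%:C.
  by have := cpow_natN 1 x0; rewrite expr1 => ->; rewrite fmorphV.
rewrite cpowD x1; case: w => a b.
have dln c : is_derive x (1 : R) (fun t : R => c * ln t : R^o) (c / x).
  have dx := is_derive1_ln x0.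
  have -> : (fun t : R => c * ln t : R^o) = c *: (@ln R : R -> R^o) by [].
  exact: is_deriveZ.
have de : is_derive x (1 : R) (@expR R \o (fun t : R => a * ln t)) (expR (a * ln x) * (a / x)).
  by apply: is_derive1_comp.
have dc : is_derive x (1 : R) (@cos R \o (fun t : R => b * ln t)) (- sin (b * ln x) * (b / x)).
  by apply: is_derive1_comp.
have ds : is_derive x (1 : R) (@sin R \o (fun t : R => b * ln t)) (cos (b * ln x) * (b / x)).
  by apply: is_derive1_comp.
split.
  have -> : (fun t : R => Re (cpow t (a +i* b)) : R^o) =
     ((@expR R \o (fun t : R => a * ln t)) : R -> R^o)
     * ((@cos R \o (fun t : R => b * ln t)) : R -> R^o) by [].
  apply: is_derive_eq; rewrite /cpow /GRing.scale !(ReM, ImM) /=; ring.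
have -> : (fun t : R => Im (cpow t (a +i* b)) : R^o) =
   ((@expR R \o (fun t : R => a * ln t)) : R -> R^o)
   * ((@sin R \o (fun t : R => b * ln t)) : R -> R^o) by [].
apply: is_derive_eq. rewrite /cpow /GRing.scale !(ReM, ImM) /=; ring.
Qed.

Lemma is_cderive_gauss x : is_cderive (fun t => (expR (- (t ^+ 2) / 2))%:C) x
  (- (x%:C * (expR (- (x ^+ 2) / 2))%:C)).
Proof.
have sq : is_derive x (1 : R) (fun t : R => - (t ^+ 2) / 2 : R^o) (- x).
  have -> : (fun t : R => - (t ^+ 2) / 2 : R^o) = (- (2^-1)) *: ((id : R -> R^o) * (id : R -> R^o)).
    by apply/funext => t; rewrite /GRing.scale /= -[RHS]/(- 2^-1 * (t * t)); ring.
  by apply: is_derive_eq; rewrite /GRing.scale /= mulr1; field.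
apply: is_cderive_eq.
  by apply: is_cderive_real; apply: (@is_derive1_comp _ expR (fun t => - (t ^+ 2) / 2)); exact: sq.
by rewrite rmorphM /= rmorphN mulrN mulrC.
Qed.

Definition gauge (w : R[i]) (q : {poly R[i]}) (t : R) : R[i] :=
  (expR (- (t ^+ 2) / 2))%:C * cpow t w * q.[(t ^+ 2)%:C].

(** The polynomial factor after one derivative, in [y = t ^+ 2]: [w] comes from the power,
    [2 y d/dy] from the chain rule, [-y] from the Gaussian. The exponent drops by one. *)
Definition gaugeD (w : R[i]) (q : {poly R[i]}) : {poly R[i]} :=
  w *: q + 2 *: ('X * deriv q) - 'X * q.

Lemma is_cderive_gauge w q x : 0 < x -> is_cderive (gauge w q) x (gauge (w - 1) (gaugeD w q) x).
Proof.
move=> x0; apply: is_cderive_eq.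
  apply: is_cderiveM; last exact: is_cderive_horner.
  apply: is_cderiveM; first exact: is_cderive_gauss.
  exact: is_cderive_cpow.
rewrite /gauge /gaugeD.
have -> : cpow x w = x%:C * cpow x (w - 1).
  by rewrite -[x%:C]/((x ^+ 1)%:C) -cpow_nat // -cpowD addrC subrK.
by rewrite !hornerE rmorphXn /=; ring.
Qed.

(** The formula for the [k]-th derivative is required on the whole half-line, since the next
    derivative depends on a neighbourhood of [x]. *)
Lemma cderivnS f (G dG : R -> R[i]) k x : 0 < x ->
    (forall t, 0 < t -> cderivn k f t = G t) -> is_cderive G x (dG x) ->
  cderivn k.+1 f x = dG x.
Proof.
move=> x0 fG [d1 d2].
have nx : \forall t \near x, 0 < t by exact: lt_nbhsr.
rewrite /cderivn !derive1nS !derive1E [LHS](_ : _ = Re (dG x) +i* Im (dG x)); last first.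
  congr (_ +i* _).
    case: d1 => _ <-; apply: near_eq_derive; apply: filterS nx => t t0.
    by rewrite -(fG t t0).
  case: d2 => _ <-; apply: near_eq_derive; apply: filterS nx => t t0.
  by rewrite -(fG t t0).
by case: (dG x).
Qed.

Fixpoint gaugeT (k : nat) (w : R[i]) (q : {poly R[i]}) : {poly R[i]} :=
  if k is k'.+1 then gaugeD (w - k'%:R) (gaugeT k' w q) else q.

Lemma cderivn_gauge k w q x : 0 < x ->
  cderivn k (gauge w q) x = gauge (w - k%:R) (gaugeT k w q) x.
Proof.
elim: k x => [|k IH] x x0.
  by rewrite /cderivn !derive1n0 subr0 /=; case: (gauge w q x).
rewrite (@cderivnS _ (gauge (w - k%:R) (gaugeT k w q))
   (gauge (w - k%:R - 1) (gaugeD (w - k%:R) (gaugeT k w q)))) //.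
  by rewrite -[k.+1%:R]natr1 opprD addrA.
exact: is_cderive_gauge.
Qed.

End ComplexDerivative.

(** * From derivatives in [x] to the rows [vrow] *)

Section GaugeRows.
Variables (R : realType) (b : R[i]).
Local Notation F := R[i].

(** The operator [sgb + 2 y d/dy], applied [a] times to the Laguerre polynomial in [y]; reversed, it
    is [vrow a l]. *)
Definition lagrow (a : nat) (l : lab) : {poly F} :=
  \poly_(i < l.2.+1) ((2 * i%:R + sgb b l.1) ^+ a * lagc b l (l.2 - i)).

Lemma lagrowS a l :
  lagrow a.+1 l = sgb b l.1 *: lagrow a l + 2 *: ('X * deriv (lagrow a l)).
Proof.
apply/polyP => j; rewrite coefD !coefZ coefX_deriv !coef_poly.
by case: ltnP => _; rewrite ?mulr0 ?addr0 // exprS; ring.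
Qed.

(** A change of rows common to all labels, unitriangular by [gcoef_gt] and [gcoef_diag]: it
    therefore leaves the determinant unchanged. *)
Fixpoint gcoef (a i : nat) : {poly F} :=
  if a is a'.+1 then
    (if i is i'.+1 then gcoef a' i' else 0) + (2^-1 - a'%:R) *: gcoef a' i
    - 'X * gcoef a' i + 2 *: ('X * deriv (gcoef a' i))
  else (i == 0%N)%:R.

Lemma gcoef_gt a i : (a < i)%N -> gcoef a i = 0.
Proof.
elim: a i => [|a IH] [|i] //= ai; rewrite !IH ?(ltnW ai) //.
by rewrite derivC !mulr0 !scaler0 subr0 !addr0.
Qed.

Lemma gcoef_diag a : gcoef a a = 1.
Proof. by elim: a => //= a ->; rewrite gcoef_gt // derivC !mulr0 !scaler0 subr0 !addr0. Qed.

Lemma gaugeT_lagrow a n l : (a < n)%N ->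
  gaugeT a (2^-1 + sgb b l.1) (lagrow 0 l) = \sum_(i < n) gcoef a i * lagrow i l.
Proof.
elim: a n => [|a IH] n an.
  case: n an => // n _; rewrite big_ord_recl /= mul1r big1 ?addr0 // => i _.
  by rewrite mul0r.
case: n an => // n an; rewrite [LHS]/= /gaugeD (IH n.+1) ?(ltnW an) //.
rewrite [deriv (\sum_(i < _) _)]raddf_sum !mulr_sumr !scaler_sumr -!big_split -sumrB /=.
under eq_bigr => i _.
  rewrite (_ : _ - _ = gcoef a i * lagrow i.+1 l + ((2^-1 - a%:R) *: gcoef a i
    - 'X * gcoef a i + 2 *: ('X * deriv (gcoef a i))) * lagrow i l).
    over.
  by rewrite lagrowS derivM -!mul_polyC !(polyCD, polyCN); ring.
rewrite big_split /= [X in X + _]big_ord_recr /= (gcoef_gt (_ : a < n)%N) // mul0r addr0.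
under [in RHS]eq_bigr do rewrite -!addrA mulrDl !addrA.
by rewrite big_split /= [X in _ = X + _]big_ord_recl /= mul0r add0r.
Qed.

Lemma lagrow_rev a l (y : F) : y != 0 ->
  (lagrow a l).[y] = y ^+ l.2 * (vrow b a l).[y^-1].
Proof.
move=> y0; rewrite !horner_poly mulr_sumr (reindex_inj rev_ord_inj) /=.
apply: eq_bigr => -[i il] _ /=; rewrite ltnS in il.
rewrite subSS subKn // [RHS]mulrCA.
have -> : 2 * (l.2 - i)%:R + sgb b l.1 = eig b l - 2 * i%:R by rewrite natrB // /eig; ring.
by congr (_ * _); rewrite exprVn expfB_cond ?(negPf y0).
Qed.

Lemma psi_gauge l x : psi l.1 b l.2 x = gauge (2^-1 + sgb b l.1) (lagrow 0 l) x.
Proof.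
rewrite /psi /gauge /laguerre -/(sgb b l.1) horner_poly; congr (_ * _).
apply: eq_bigr => -[i il] _ /=; rewrite ltnS in il.
rewrite expr0 mul1r /lagc subKn // bin_sub //; congr (_ * _ * _ * _).
by rewrite -signr_odd oddD -oddB // signr_odd.
Qed.

End GaugeRows.

Section Labels.
Variables (r s : nat) (m : 'I_r -> nat) (n : 'I_s -> nat).

Definition labs (c : 'I_(r + s)) : lab :=
  match fintype.split c with inl i => (true, m i) | inr j => (false, n j) end.

Definition labseq : seq lab := [seq labs c | c <- enum 'I_(r + s)].

Lemma size_labseq : size labseq = (r + s)%N.
Proof. by rewrite size_map size_enum_ord. Qed.

Lemma nth_labseq (c : 'I_(r + s)) : nth l0 labseq c = labs c.
Proof. by rewrite (nth_map c) ?size_enum_ord // nth_ord_enum. Qed.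

Lemma labs_lshift i : labs (lshift s i) = (true, m i).
Proof. by rewrite /labs -[lshift s i]/(unsplit (inl i)) unsplitK. Qed.

Lemma labs_rshift j : labs (rshift r j) = (false, n j).
Proof. by rewrite /labs -[rshift r j]/(unsplit (inr j)) unsplitK. Qed.

Lemma big_labseq (T : Type) (idx : T) (op : Monoid.com_law idx) (P : pred lab) (f : lab -> T) :
  \big[op/idx]_(l <- labseq | P l) f l =
  op (\big[op/idx]_(i < r | P (true, m i)) f (true, m i))
     (\big[op/idx]_(j < s | P (false, n j)) f (false, n j)).
Proof.
rewrite big_map big_enum_cond /= big_split_ord.
congr (op _ _); apply: eq_big => i; rewrite ?labs_lshift ?labs_rshift //.
Qed.

Lemma tot_labseq : tot labseq = (\sum_(i < r) m i + \sum_(j < s) n j)%N.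
Proof. by rewrite /tot big_labseq. Qed.

Lemma size_fam_labseq sg : size (fam sg labseq) = if sg then r else s.
Proof.
rewrite size_fam big_labseq /=; case: sg => /=.
  by rewrite sum1_card card_ord big1 ?addn0.
by rewrite big1 // sum1_card card_ord add0n.
Qed.

Lemma low_labseq : low labseq = ('C(r, 2) + 'C(s, 2))%N.
Proof. by rewrite /low !size_fam_labseq. Qed.

Lemma dimPhi_labseq : dimPhi m n = (tot labseq - low labseq)%N.
Proof. by rewrite /dimPhi tot_labseq low_labseq subnDA. Qed.

Hypothesis hm : forall i j : 'I_r, (i < j)%N -> (m j < m i)%N.
Hypothesis hn : forall i j : 'I_s, (i < j)%N -> (n j < n i)%N.

Lemma decreasing_inj k (v : 'I_k -> nat) :
  (forall i j : 'I_k, (i < j)%N -> (v j < v i)%N) -> injective v.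
Proof.
move=> hv i j vij; apply/val_inj; case: (ltngtP i j) => // /hv; by rewrite vij ltnn.
Qed.

Lemma uniq_labseq : uniq labseq.
Proof.
rewrite map_inj_uniq ?enum_uniq // => c c'; rewrite -(splitK c) -(splitK c').
case: (fintype.split c) => i; case: (fintype.split c') => j /=;
  rewrite ?labs_lshift ?labs_rshift // => -[].
  by move/(decreasing_inj hm) ->.
by move/(decreasing_inj hn) ->.
Qed.

End Labels.

Section PsiTau.
Variables (R : realType) (r s : nat) (m : 'I_r -> nat) (n : 'I_s -> nat) (b : R[i]).
Local Notation L := (labs m n).
Local Notation sL := (labseq m n).

Lemma kap_labseq : kap b sL = kappa m n b.
Proof.
have kapE k (t : seq lab) : size t = k ->
    kap b t = Delta (fun c : 'I_k => eig b (nth l0 t c)) by move=> <-.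
rewrite (kapE _ _ (size_labseq m n)) /kappa /Delta.
apply: eq_bigr => i _; apply: eq_bigr => j _; rewrite !nth_labseq /labs.
by case: (fintype.split i) => ?; case: (fintype.split j).
Qed.

(** The Wronskian matrix factors into diagonal matrices for the row powers, the column prefactors
    and the reversal powers of [y], the unitriangular [G], and the matrix [V] whose determinant is
    [tau] at [y^-1]. *)
Lemma Psi_tau x : 0 < x -> Psi m n b x =
  (\prod_(a < r + s) cpow x (- a%:R)) *
  (\prod_(c < r + s) ((expR (- (x ^+ 2) / 2))%:C * cpow x (2^-1 + sgb b (L c).1))) *
  ((x ^+ 2)%:C ^+ tot sL * (tau b sL).[((x ^+ 2)%:C)^-1]).
Proof.
move=> x0; set y := (x ^+ 2)%:C.
have y0 : y != 0.
    by rewrite /y -(rmorph0 (real_complex R)) (inj_eq (@complexI R)) expf_neq0 // gt_eqF.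
set e := (expR _)%:C.
pose rw : 'rV[R[i]]_(r + s) := \row_a cpow x (- a%:R).
pose cl : 'rV[R[i]]_(r + s) := \row_c (e * cpow x (2^-1 + sgb b (L c).1)).
pose G : 'M[R[i]]_(r + s) := \matrix_(a, i) (gcoef R a i).[y].
pose V : 'M[R[i]]_(r + s) := \matrix_(i, c) (vrow b i (L c)).[y^-1].
pose yk : 'rV[R[i]]_(r + s) := \row_c y ^+ (L c).2.
have -> : Psi m n b x = \det (diag_mx rw *m (G *m (V *m diag_mx yk)) *m diag_mx cl).
  congr (\det _); apply/matrixP => a c; rewrite mul_mx_diag mul_diag_mx [in RHS]mxE.
  rewrite [X in X * _]mxE [in LHS]mxE.
  have -> : psi_family m n b c = gauge (2^-1 + sgb b (L c).1) (lagrow b 0 (L c)).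
    apply/funext => t; rewrite -psi_gauge /psi_family /labs.
    by case: (fintype.split c).
  rewrite cderivn_gauge // /gauge -/y -/e (gaugeT_lagrow _ _ (ltn_ord a)) cpowD.
  rewrite horner_sum.
  have -> : (G *m (V *m diag_mx yk)) a c = \sum_(i < r + s) (gcoef R a i * lagrow b i (L c)).[y].
    rewrite mul_mx_diag mxE; apply: eq_bigr => i _.
    by rewrite !mxE hornerM lagrow_rev // [y ^+ _ * _]mulrC.
  rewrite !mxE; ring.
rewrite !det_mulmx !det_diag.
have -> : \det G = 1.
  rewrite det_trig; last by apply/is_trig_mxP => i j ij; rewrite mxE gcoef_gt // horner0.
  by rewrite big1 // => i _; rewrite mxE gcoef_diag hornerC.
have -> : \det V = (tau b sL).[y^-1].
  rewrite (tauE _ (size_labseq m n)) -[RHS]/(horner_eval _ _) -det_map_mx; congr (\det _).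
  by apply/matrixP => i c; rewrite !mxE /= nth_labseq.
have -> : \prod_i yk 0 i = y ^+ tot sL.
  rewrite /tot big_map big_enum /= expr_sum; apply: eq_bigr => c _.
  by rewrite mxE.
have -> : \prod_i rw 0 i = \prod_(a < r + s) cpow x (- a%:R) by apply: eq_bigr => a _; rewrite mxE.
have -> : \prod_i cl 0 i = \prod_(c < r + s) (e * cpow x (2^-1 + sgb b (L c).1)).
  by apply: eq_bigr => a _; rewrite mxE.
by rewrite mul1r [_ * y ^+ _]mulrC mulrAC.
Qed.

Lemma bin2R (F : comNzRingType) (k : nat) : 2 * 'C(k, 2)%:R = k%:R * (k%:R - 1) :> F.
Proof.
elim: k => [|k IH]; first by rewrite mulr0 mul0r.
by rewrite binS bin1 natrD mulrDr IH -natr1; ring.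
Qed.

Lemma bin3R (F : comNzRingType) (k : nat) :
  6 * 'C(k, 3)%:R = k%:R * (k%:R - 1) * (k%:R - 2) :> F.
Proof.
elim: k => [|k IH]; first by rewrite mulr0 !mul0r.
rewrite binS natrD mulrDr IH -natr1.
have -> : 6 * 'C(k, 2)%:R = 3 * (2 * 'C(k, 2)%:R) :> F by ring.
by rewrite bin2R; ring.
Qed.

Lemma cpow_prod (I : Type) (t : seq I) x (f : I -> R[i]) :
  \prod_(i <- t) cpow x (f i) = cpow x (\sum_(i <- t) f i).
Proof.
elim/big_rec2: _ => [|i w _ _ ->]; first by rewrite cpow0.
by rewrite cpowD.
Qed.

Lemma exponent_alg (F : fieldType) (u v C Cu Cv z : F) : (2 : F) != 0 ->
    2 * C = (u + v) * (u + v - 1) -> 2 * Cu = u * (u - 1) -> 2 * Cv = v * (v - 1) ->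
  - C + (u * (2^-1 + z) + v * (2^-1 - z)) + 2 * (Cu + Cv)
  = (u - v) ^+ 2 / 2 + z * (u - v).
Proof.
move=> two0 E1 E2 E3; apply: (mulfI two0).
transitivity (- (2 * C) + u * (1 + 2 * z) + v * (1 - 2 * z) + 2 * (2 * Cu + 2 * Cv)).
  by field.
by rewrite E1 E2 E3; field.
Qed.

(** Of the power [y ^+ tot], the part [low] belongs to the prefactor: its exponent [2 * low] in [x]
    is [r (r - 1) + s (s - 1)], which completes the other exponents to [(r - s)^2 / 2]. *)
Lemma gauge_exponents x : 0 < x ->
  (\prod_(a < r + s) cpow x (- a%:R)) *
  (\prod_(c < r + s) ((expR (- (x ^+ 2) / 2))%:C * cpow x (2^-1 + sgb b (L c).1))) *
  (x ^+ 2)%:C ^+ low sL =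
  (expR (- ((r + s)%:R * x ^+ 2) / 2))%:C *
  cpow x ((((r : int) - (s : int))%:~R) ^+ 2 / 2 + b * ((r : int) - (s : int))%:~R).
Proof.
move=> x0; rewrite big_split /= prodr_const card_ord.
have -> : (expR (- (x ^+ 2) / 2))%:C ^+ (r + s) = (expR (- ((r + s)%:R * x ^+ 2) / 2))%:C :> R[i].
  by rewrite -rmorphXn /= -expRM_natl; congr ((expR _)%:C); ring.
have -> : (x ^+ 2)%:C ^+ low sL = cpow x (2 * (low sL))%:R.
  by rewrite cpow_nat // exprM [RHS]rmorphXn.
rewrite !cpow_prod [X in X * _]mulrCA -mulrA -!cpowD; congr (_ * cpow x _).
have -> : \sum_(a < r + s) - a%:R = - ('C(r + s, 2))%:R :> R[i].
  by rewrite sumrN -natr_sum -bin2_sum big_mkord.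
have -> : \sum_(c < r + s) (2^-1 + sgb b (L c).1) = r%:R * (2^-1 + b) + s%:R * (2^-1 - b).
  rewrite big_split_ord /=.
  under eq_bigr do rewrite labs_lshift /=.
  under [X in _ + X]eq_bigr do rewrite labs_rshift /=.
  by rewrite !sumr_const !card_ord !mulr_natl.
rewrite low_labseq natrM natrD rmorphB /=.
apply: exponent_alg; rewrite ?pnatr_eq0 ?bin2R ?natrD //.
Qed.

End PsiTau.

(** * The theorem *)

Section TopFormulas.
Variables (r s : nat) (m : 'I_r -> nat) (n : 'I_s -> nat).
Local Notation sL := (labseq m n).

Lemma sum_shift_pow (A : comNzRingType) k (v : 'I_k -> nat) (z : A)
    (p := fun e => \sum_(i < k) (v i ^ e)%N%:R : A) :
  [/\ \sum_(i < k) (2 * (v i)%:R + z) = 2 * p 1%N + k%:R * z,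
      \sum_(i < k) (2 * (v i)%:R + z) ^+ 2 = 4 * p 2 + 4 * z * p 1%N + k%:R * z ^+ 2 &
      \sum_(i < k) (2 * (v i)%:R + z) ^+ 3
        = 8 * p 3 + 12 * z * p 2 + 6 * z ^+ 2 * p 1%N + k%:R * z ^+ 3].
Proof.
rewrite /p {p}; elim: k v => [|k IH] v; first by rewrite !big_ord0 !mul0r !mulr0 !addr0.
have [E1 E2 E3] := IH (fun i => v (widen_ord (leqnSn k) i)).
by rewrite !big_ord_recr /= E1 E2 E3 !natrX -natr1; split; ring.
Qed.

Lemma psum_labseq (phi := map_poly intr : {poly int} -> {poly rat})
    (N := ((r + s)%:R)%:P : {poly rat}) (rs := (r%:R - s%:R)%:P : {poly rat})
    (rp := fun k => (rho true m n k)%:P) (rm := fun k => (rho false m n k)%:P) :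
  [/\ phi (psum sL 1) = 2 * rp 1%N + rs * 'X,
      phi (psum sL 2) = 4 * rp 2 + 4 * 'X * rm 1%N + N * 'X ^+ 2 &
      phi (psum sL 3) = 8 * rp 3 + 12 * 'X * rm 2 + 6 * 'X ^+ 2 * rp 1%N + rs * 'X ^+ 3].
Proof.
have phiE k : phi (psum sL k) = \sum_(i < r) (2 * (m i)%:R + 'X) ^+ k
    + \sum_(j < s) (2 * (n j)%:R - 'X) ^+ k.
  rewrite /phi /psum big_labseq /= rmorphD !rmorph_sum /=.
  by congr (_ + _); apply: eq_bigr => i _;
    rewrite rmorphXn (eig_map (map_poly intr)) /= map_polyX.
have rhoE k : rp k = \sum_(i < r) (m i ^ k)%N%:R + \sum_(j < s) (n j ^ k)%N%:R.
  rewrite /rp /rho mul1r polyCD !rmorph_sum /=.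
  by congr (_ + _); apply: eq_bigr => i _; rewrite rmorph_nat.
have rhoN k : rm k = \sum_(i < r) (m i ^ k)%N%:R - \sum_(j < s) (n j ^ k)%N%:R.
  rewrite /rm /rho mulN1r polyCB !rmorph_sum /=.
  by congr (_ - _); apply: eq_bigr => i _; rewrite rmorph_nat.
have [A1 A2 A3] := sum_shift_pow m ('X : {poly rat}).
have [B1 B2 B3] := sum_shift_pow n (- 'X : {poly rat}).
have NE : N = r%:R + s%:R by rewrite /N natrD polyCD !rmorph_nat.
have rsE : rs = r%:R - s%:R by rewrite /rs polyCB !rmorph_nat.
rewrite !phiE !rhoE !rhoN NE rsE A2 A3 B2 B3.
have e1 : \sum_(i < r) (2 * (m i)%:R + 'X) ^+ 1
    = \sum_(i < r) (2 * (m i)%:R + 'X) :> {poly rat} by [].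
have e2 : \sum_(i < s) (2 * (n i)%:R - 'X) ^+ 1
    = \sum_(i < s) (2 * (n i)%:R - 'X) :> {poly rat} by [].
rewrite e1 e2 A1 B1; split; ring.
Qed.

End TopFormulas.

Section TopAlgebra.
Variables (r s p1 p2 p3 q1 q2 Rb Sb C3 : rat).
Let N := r + s.
Let rs := r - s.
Hypothesis RbE : 2 * Rb = r * (r - 1).
Hypothesis SbE : 2 * Sb = s * (s - 1).
Hypothesis C3E : 6 * C3 = N * (N - 1) * (N - 2).
Variables (S1 S2 S3 f1 f2 : {poly rat}).
Hypothesis S1E : S1 = 2 * p1%:P + rs%:P * 'X.
Hypothesis S2E : S2 = 4 * p2%:P + 4 * 'X * q1%:P + N%:P * 'X ^+ 2.
Hypothesis S3E : S3 = 8 * p3%:P + 12 * 'X * q2%:P + 6 * 'X ^+ 2 * p1%:P + rs%:P * 'X ^+ 3.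
Hypothesis f1E : 12 * f1 = - 3 * S2 + 6 * (N%:P - 1) * S1
  - 2 * N%:P * (N%:P - 1) * (N%:P - 2) + 3 * N%:P * 'X ^+ 2.

Let natP (k : nat) (c : rat) : k%:R * c%:P = (k%:R * c)%:P.
Proof. by rewrite polyCM rmorph_nat. Qed.

Lemma top1_formula :
  f1 = (- p2 + (N - 1) * p1 - C3)%:P - 'X * (q1 - Rb + Sb)%:P.
Proof.
have k0 : (12%:R : {poly rat}) != 0 by rewrite -polyC_natr polyC_eq0 pnatr_eq0.
apply: (mulfI k0); rewrite mulrBr natP mulrCA natP f1E S1E S2E.
have -> : 12 * (- p2 + (N - 1) * p1 - C3) = - 12 * p2 + 12 * (N - 1) * p1
   - 2 * (N * (N - 1) * (N - 2)) by rewrite -C3E; ring.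
have -> : 12 * (q1 - Rb + Sb) = 12 * q1 - 6 * (r * (r - 1)) + 6 * (s * (s - 1)).
  by rewrite -RbE -SbE; ring.
by rewrite /N /rs; ring.
Qed.

Hypothesis f2E : 8 * f2 = 4 * f1 ^+ 2 + (S1 ^+ 2 - S3 + 3 * (N%:P - 1) * S2
  - 4 * (N%:P - 1) ^+ 2 * S1 + N%:P * (N%:P - 1) ^+ 2 * (N%:P - 2)
  + 'X ^+ 2 * (S1 - 2 * N%:P ^+ 2 + N%:P)).

Lemma scaled_poly2 (k c0 c1 c2 : rat) (f : {poly rat}) : k != 0 ->
    k%:P * f = (k * c0)%:P + 'X * (k * c1)%:P + 'X ^+ 2 * (k * c2)%:P ->
  f = c0%:P + 'X * c1%:P + 'X ^+ 2 * c2%:P.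
Proof.
move=> k0 E; have kP : k%:P != 0 by rewrite polyC_eq0.
by apply: (mulfI kP); rewrite E !polyCM; ring.
Qed.

Lemma top2_formula :
  f2 = (p2 ^+ 2 / 2 - p3 - (N - 1) * p2 * p1
        + (N - 1) * (N ^+ 2 - 2 * N + 9) / 6 * p2
        + (N ^+ 2 - 2 * N + 2) / 2 * p1 ^+ 2
        - (N - 1) ^+ 2 * (N ^+ 2 - 2 * N + 6) / 6 * p1
        + N * (N - 1) ^+ 2 * (N - 2) * (N ^+ 2 - 2 * N + 9) / 72)%:P
       + 'X * (p2 * q1 - 3 / 2 * q2 - (N - 1) * (p1 * q1 + rs / 2 * p2)
               + (N ^+ 2 - 2 * N + 2) * rs / 2 * p1
               + (N - 1) * (N ^+ 2 - 2 * N + 9) / 6 * q1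
               - (N ^+ 2 - 2 * N + 6) * (N - 1) ^+ 2 * rs / 12)%:P
       + 'X ^+ 2 * (q1 ^+ 2 / 2 - p1 / 2 - (Rb - Sb) * q1
                    + (Rb * (Rb + 1) + Sb * (Sb + 1)) / 2 - Rb * Sb)%:P.
Proof.
(* The scale [288 = 2 * 12 ^ 2] clears all denominators, and [288 f2] is then [(12 f1) ^ 2] plus 36
   times the logarithmic combination in [f2E]. *)
apply: (@scaled_poly2 288) => //; rewrite polyC_natr.
have -> : 288 * f2 = (12 * f1) ^+ 2 + 36 * (8 * f2 - 4 * f1 ^+ 2) by ring.
rewrite f2E f1E S1E S2E S3E [4 * f1 ^+ 2 + _]addrC addrK.
rewrite [X in _ = X%:P + _ + _](_ : _ = 144 * p2 ^+ 2 - 288 * p3 - 288 * (N - 1) * p2 * p1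
  + 48 * (N - 1) * (N ^+ 2 - 2 * N + 9) * p2 + 144 * (N ^+ 2 - 2 * N + 2) * p1 ^+ 2
  - 48 * (N - 1) ^+ 2 * (N ^+ 2 - 2 * N + 6) * p1
  + 4 * N * (N - 1) ^+ 2 * (N - 2) * (N ^+ 2 - 2 * N + 9)); last by field.
rewrite [X in _ = _ + 'X * X%:P + _](_ : _ = 288 * p2 * q1 - 432 * q2
  - 288 * (N - 1) * p1 * q1 - 144 * (N - 1) * rs * p2 + 144 * (N ^+ 2 - 2 * N + 2) * rs * p1
  + 48 * (N - 1) * (N ^+ 2 - 2 * N + 9) * q1
  - 24 * (N ^+ 2 - 2 * N + 6) * (N - 1) ^+ 2 * rs); last by field.
rewrite [X in _ = _ + 'X ^+ 2 * X%:P](_ : _ = 144 * q1 ^+ 2 - 144 * p1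
  - 144 * (r * (r - 1) - s * (s - 1)) * q1 + 36 * ((r * (r - 1)) * (r * (r - 1) + 2)
  + (s * (s - 1)) * (s * (s - 1) + 2)) - 72 * (r * (r - 1)) * (s * (s - 1))); last first.
  by rewrite -RbE -SbE; field.
by rewrite /N /rs; ring.
Qed.

End TopAlgebra.

Lemma poch_add (F : comNzRingType) (z : F) a c : poch z (a + c) = poch z a * poch (z + a%:R) c.
Proof.
rewrite /poch big_split_ord; congr (_ * _); apply: eq_bigr => j _.
by rewrite natrD addrA.
Qed.

(** For [a < i] as well: the convention for negative index inverts precisely the factors by which
    the longer product exceeds the shorter one. *)
Lemma pochZ_ratio (K : fieldType) (z : K) (a i : nat) : (forall k, poch (z + 1) k != 0) ->
  pochZ (z + i.+1%:R) ((a : int) - (i : int)) = poch (z + 1) a / poch (z + 1) i.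
Proof.
move=> p0; have zE k : z + k.+1%:R = z + 1 + k%:R by rewrite -addrA nat1r.
have [ia|ai] := leqP i a.
  rewrite subzn //= zE -{2}(subnKC ia) poch_add mulrAC mulfV ?mul1r //.
have -> : (a : int) - (i : int) = Negz (i - a).-1.
  by rewrite NegzE prednK ?subn_gt0 // -subzn ?(ltnW ai) // opprB.
rewrite /= prednK ?subn_gt0 //.
have -> : \prod_(j < i - a) (z + i.+1%:R - j.+1%:R) = poch (z + 1 + a%:R) (i - a).
  rewrite /poch (reindex_inj rev_ord_inj) /=; apply: eq_bigr => -[j jl] _ /=.
  rewrite subnSK // natrB; last exact: ltnW.
  by rewrite natrB ?(ltnW ai) // -natr1; ring.
have E := poch_add (z + 1) a (i - a); rewrite subnKC ?(ltnW ai) // in E.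
by rewrite E invfM mulrA mulfV // mul1r.
Qed.

Lemma phi0F_labseq (r s : nat) (m : 'I_r -> nat) (n : 'I_s -> nat)
    (K : fieldType) (be : K) : (forall z : int, be != z%:~R) -> uniq (labseq m n) ->
  phi0F be (labseq m n) = (-1) ^+ dimPhi m n
    * (\prod_(i < r) pochZ (be + (i.+1)%:R) ((m i : int) - (i : int)))
    * (\prod_(j < s) pochZ (- be + (j.+1)%:R) ((n j : int) - (j : int)))
    * (\prod_(i < r) \prod_(j < s)
         ((((j : int) - (i : int))%:~R - be) / (((n j : int) - (m i : int))%:~R - be))).
Proof.
move=> be0 us.
have p0 sg k : poch (sgb be sg + 1) k != 0 := poch_sgb_neq0 be0 sg k.
have -> : \prod_(i < r) pochZ (be + (i.+1)%:R) ((m i : int) - (i : int)) =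
    (\prod_(i < r) poch (sgb be true + 1) (m i)) / \prod_(i < r) poch (sgb be true + 1) i.
  rewrite -prodf_div; apply: eq_bigr => i _.
  by rewrite (pochZ_ratio _ _ (p0 true)).
have -> : \prod_(j < s) pochZ (- be + (j.+1)%:R) ((n j : int) - (j : int)) =
    (\prod_(j < s) poch (sgb be false + 1) (n j)) / \prod_(j < s) poch (sgb be false + 1) j.
  rewrite -prodf_div; apply: eq_bigr => j _.
  by rewrite (pochZ_ratio _ _ (p0 false)).
have -> : \prod_(i < r) \prod_(j < s)
     ((((j : int) - (i : int))%:~R - be) / (((n j : int) - (m i : int))%:~R - be)) =
   (\prod_(i < r) \prod_(j < s) (j%:R - i%:R - be)) / mix be (labseq m n).
  have -> : mix be (labseq m n) = \prod_(i < r) \prod_(j < s) ((n j)%:R - (m i)%:R - be).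
    rewrite /mix big_map big_filter big_labseq /= [X in _ * X]big1 // mulr1.
    apply: eq_bigr => i _; rewrite big_map big_filter big_labseq /= big1 ?mul1r //.
  rewrite -prodf_div; apply: eq_bigr => i _; rewrite -prodf_div; apply: eq_bigr => j _.
  by rewrite !rmorphB.
have -> : (-1) ^+ dimPhi m n = (-1) ^+ (tot (labseq m n) + low (labseq m n)) :> K.
  rewrite dimPhi_labseq -signr_odd -[RHS]signr_odd; congr (_ ^+ nat_of_bool _).
  by rewrite oddB ?low_le_tot // oddD.
rewrite /phi0F /stairc !size_fam_labseq big_labseq /= invfM.
move: ((-1) ^+ _) (_^-1) (_^-1) (_^-1) => e a1 a2 a3.
by rewrite !mulrA; ring.
Qed.

Lemma regroup_mul (A : comNzRingType) (a c l e k p : A) :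
  a * c * (l * e * (k * p)) = k * (a * c * l) * (e * p).
Proof. by ring. Qed.

Theorem theorem2p2 (R : realType) (r s : nat)
  (m : 'I_r -> nat) (n : 'I_s -> nat)
  (hm : forall i j : 'I_r, (i < j)%N -> (m j < m i)%N)
  (hn : forall i j : 'I_s, (i < j)%N -> (n j < n i)%N) :
  let d := dimPhi m n in
  let N : rat := (r + s)%:R in
  let rs : rat := r%:R - s%:R in
  let Rb : rat := ('C(r, 2))%:R in
  let Sb : rat := ('C(s, 2))%:R in
  let rp := rho true m n in
  let rm := rho false m n in
  let X : {poly rat} := 'X in
  let bF : {fraction {poly int}} := tofrac ('X : {poly int}) in
  exists Phi : {poly {poly int}},
    [/\ Phi \is monic, size Phi = d.+1,
        (forall (b : R[i]) (x : R), 0 < x ->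
           Psi m n b x =
             kappa m n b * (expR (- ((r + s)%:R * x ^+ 2) / 2))%:C
             * cpow x ((((r : int) - (s : int))%:~R) ^+ 2 / 2
                       + b * ((r : int) - (s : int))%:~R)
             * evalZ2 Phi b (x ^+ 2)%:C),
        (forall k, (k <= d)%N -> leq (size (Phi`_k)) (d - k).+1) &
        [/\ tofrac (Phi`_0) =
              (-1) ^+ d
              * (\prod_(i < r) pochZ (bF + (i.+1)%:R) ((m i : int) - (i : int)))
              * (\prod_(j < s) pochZ (- bF + (j.+1)%:R) ((n j : int) - (j : int)))
              * (\prod_(i < r) \prod_(j < s)
                   ((((j : int) - (i : int))%:~R - bF)
                    / (((n j : int) - (m i : int))%:~R - bF))),
            Phi`_d = 1,
            (0 < d)%N ->
              map_poly intr (Phi`_d.-1) =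
                (- rp 2 + (N - 1) * rp 1 - ('C(r + s, 3))%:R)%:P
                - X * (rm 1 - Rb + Sb)%:P &
            (1 < d)%N ->
              map_poly intr (Phi`_(d - 2)) =
                (rp 2 ^+ 2 / 2 - rp 3 - (N - 1) * rp 2 * rp 1
                 + (N - 1) * (N ^+ 2 - 2 * N + 9) / 6 * rp 2
                 + (N ^+ 2 - 2 * N + 2) / 2 * rp 1 ^+ 2
                 - (N - 1) ^+ 2 * (N ^+ 2 - 2 * N + 6) / 6 * rp 1
                 + N * (N - 1) ^+ 2 * (N - 2) * (N ^+ 2 - 2 * N + 9) / 72)%:P
                + X * (rp 2 * rm 1 - 3 / 2 * rm 2
                       - (N - 1) * (rp 1 * rm 1 + rs / 2 * rp 2)
                       + (N ^+ 2 - 2 * N + 2) * rs / 2 * rp 1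
                       + (N - 1) * (N ^+ 2 - 2 * N + 9) / 6 * rm 1
                       - (N ^+ 2 - 2 * N + 6) * (N - 1) ^+ 2 * rs / 12)%:P
                + X ^+ 2 * (rm 1 ^+ 2 / 2 - rp 1 / 2 - (Rb - Sb) * rm 1
                            + (Rb * (Rb + 1) + Sb * (Sb + 1)) / 2 - Rb * Sb)%:P]].
Proof.
move=> d N rs Rb Sb rp rm X bF.
have us := uniq_labseq hm hn.
have [Q qQ] := ex_quot us.
have dE : d = (tot (labseq m n) - low (labseq m n))%N := dimPhi_labseq m n.
have Q0 := quot_coef0 us qQ.
have szQ : (size Q <= d.+1)%N by rewrite dE; apply: size_quot.
pose Phi : {poly {poly int}} := \poly_(k < d.+1) Q`_(d - k).
have PhiE k : (k <= d)%N -> Phi`_k = Q`_(d - k) by move=> kd; rewrite coef_poly ltnS kd.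
have szP : size Phi = d.+1 by rewrite size_poly_eq // subnn Q0 oner_eq0.
have [T1 T2] := quot_top us qQ.
have [S1 S2 S3] := psum_labseq m n.
have RbE : 2 * Rb = r%:R * (r%:R - 1) := bin2R _ r.
have SbE : 2 * Sb = s%:R * (s%:R - 1) := bin2R _ s.
have C3E : 6 * 'C(r + s, 3)%:R = (r%:R + s%:R) * (r%:R + s%:R - 1) * (r%:R + s%:R - 2) :> rat.
  by rewrite bin3R natrD.
have NE : N = r%:R + s%:R by rewrite /N natrD.
have szE : map_poly intr ((size (labseq m n))%:R : {poly int}) = (r%:R + s%:R)%:P :> {poly rat}.
  by rewrite rmorph_nat size_labseq -natrD rmorph_nat.
rewrite -/N NE in S2.
have F1 : 12 * map_poly intr Q`_1 = - 3 * map_poly intr (psum (labseq m n) 2)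
    + 6 * ((r%:R + s%:R)%:P - 1) * map_poly intr (psum (labseq m n) 1)
    - 2 * (r%:R + s%:R)%:P * ((r%:R + s%:R)%:P - 1) * ((r%:R + s%:R)%:P - 2)
    + 3 * (r%:R + s%:R)%:P * 'X ^+ 2 :> {poly rat}.
  rewrite -szE -(map_polyX (intr : int -> rat)).
  have -> : 12 * map_poly intr Q`_1 = map_poly intr (12 * Q`_1) :> {poly rat}.
    by rewrite rmorphM rmorph_nat.
  by rewrite T1 /top1; ring.
have F2 : 8 * map_poly intr Q`_2 = 4 * (map_poly intr Q`_1) ^+ 2
    + (map_poly intr (psum (labseq m n) 1) ^+ 2 - map_poly intr (psum (labseq m n) 3)
    + 3 * ((r%:R + s%:R)%:P - 1) * map_poly intr (psum (labseq m n) 2)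
    - 4 * ((r%:R + s%:R)%:P - 1) ^+ 2 * map_poly intr (psum (labseq m n) 1)
    + (r%:R + s%:R)%:P * ((r%:R + s%:R)%:P - 1) ^+ 2 * ((r%:R + s%:R)%:P - 2)
    + 'X ^+ 2 * (map_poly intr (psum (labseq m n) 1) - 2 * (r%:R + s%:R)%:P ^+ 2
    + (r%:R + s%:R)%:P)) :> {poly rat}.
  rewrite -szE -(map_polyX (intr : int -> rat)).
  have -> : 8 * map_poly intr Q`_2 = map_poly intr (8 * Q`_2) :> {poly rat}.
    by rewrite rmorphM rmorph_nat.
  by rewrite T2 /top2; ring.
exists Phi; split=> //.
- by rewrite monicE lead_coefE szP /= PhiE // subnn Q0.
- move=> b x x0; rewrite Psi_tau //.
  (* Evaluation of [Z[b]] at a complex [b]. The integral factorisation is transported along it, so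
     it also covers those [b] at which [kappa] vanishes. *)
  pose f : {rmorphism {poly int} -> R[i]} := horner_eval b \o map_poly intr.
  have fb : f bX = b by rewrite /f /= map_polyX /horner_eval hornerX.
  have tE : tau b (labseq m n) = (kappa m n b)%:P * map_poly f Q.
    by rewrite -kap_labseq -{1 2}fb -tau_map -kap_map qQ rmorphM /= map_polyC.
  set y := (x ^+ 2)%:C.
  have y0 : y != 0.
    by rewrite /y -(rmorph0 (real_complex R)) (inj_eq (@complexI R)) expf_neq0 // gt_eqF.
  have evE : evalZ2 Phi b y = y ^+ d * (map_poly f Q).[y^-1].
    rewrite (@horner_coef_wide _ d.+1); last by rewrite (leq_trans (size_poly _ _)).
    rewrite /evalZ2 szP mulr_sumr (reindex_inj rev_ord_inj) /=; apply: eq_bigr => -[k kd] _ /=.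
    rewrite ltnS in kd.
    rewrite subSS PhiE ?leq_subr // subKn // coef_map [RHS]mulrCA; congr (_ * _).
    by rewrite exprVn expfB_cond ?(negPf y0).
  rewrite tE hornerM hornerC.
  have -> : tot (labseq m n) = (low (labseq m n) + d)%N by rewrite dE subnKC // low_le_tot.
  rewrite [y ^+ (_ + _)]exprD evE [LHS]regroup_mul.
  by rewrite [X in _ * X * _](gauge_exponents m n b x0) [kappa m n b * (_ * _)]mulrA.
- by move=> k kd; rewrite PhiE //; apply: size_quot_coef us qQ.
split.
- rewrite PhiE // subn0 [in LHS]dE (phi0_quot us qQ).
  exact: (phi0F_labseq tofracX_nint us).
- by rewrite PhiE // subnn.
- move=> d0; rewrite PhiE ?leq_pred // (_ : d - d.-1 = 1)%N; last by rewrite -subn1 subKn.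
  by rewrite NE; apply: (top1_formula RbE SbE C3E S1 S2 F1).
move=> d1; rewrite PhiE ?leq_subr // subKn // NE.
by apply: (top2_formula RbE SbE S1 S2 S3 F1 F2).
Qed.
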